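(* The Firefighter problem is fixed-parameter tractable with respect to the combined parameter $k$ and $\Delta(G)$: there is an algorithm that, given an instance $(G,s,b,k)$ with $G$ of maximum degree $\Delta$, decides it in time $f(k,\Delta)\cdot n^{O(1)}$ for some computable function $f$, where $n$ is the instance size.
   Context: Firefighter process: given a graph $G=(V,E)$, a vertex $s\in V$ and a budget $b\in\mathbb{N}$, at step $t=0$ the vertex $s$ is burned. At every step $t>0$: (1) protection phase: at most $b$ vertices not yet burned become protected; (2) spreading phase: every unprotected vertex adjacent to a burned vertex becomes burned. Burned and protected vertices stay so; the process stops when no new vertex can become burned. The Firefighter problem: given $G$, $s\in V$ and positive integers $b,k$, decide whether there is a protection strategy with budget $b$ such that at most $k$ vertices are burned when the fire starts at $s$. *)

(* Defs.v *)
From Stdlib Require Import BinNat BinPos.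
From mathcomp Require Import all_boot.
Set Implicit Arguments.
Unset Strict Implicit.
Unset Printing Implicit Defensive.

(* A graph on vertex set 'I_n is a relation e : rel 'I_n (assumed
   symmetric and irreflexive where used).  A protection strategy P
   gives, for every step t >= 1, the set P t of vertices that become
   protected at step t (P 0 is ignored). *)

Section Firefighter.
Variables (n : nat) (e : rel 'I_n) (s : 'I_n).

Fixpoint ff_state (P : nat -> {set 'I_n}) (t : nat) : {set 'I_n} * {set 'I_n} :=
  match t with
  | 0 => ([set s], set0)
  | t'.+1 =>
      let BPr := ff_state P t' in
      let B := BPr.1 in
      let Pr' := BPr.2 :|: P t'.+1 in
      (B :|: [set v | (v \notin Pr') && [exists u in B, e u v]], Pr')
  end.

Definition burned (P : nat -> {set 'I_n}) (t : nat) : {set 'I_n} :=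
  (ff_state P t).1.

Definition valid_strategy (b : nat) (P : nat -> {set 'I_n}) : Prop :=
  forall t, #|P t.+1| <= b /\ [disjoint P t.+1 & burned P t].

(* yes-instance: some strategy with budget b keeps the number of burned
   vertices at most k during the whole process (burned sets are
   increasing, so this is the number burned when the process stops) *)
Definition Firefighter (b k : nat) : Prop :=
  exists P, valid_strategy b P /\ forall t, #|burned P t| <= k.

End Firefighter.

Definition maxdeg (n : nat) (e : rel 'I_n) : nat :=
  \max_(v : 'I_n) #|[set u | e v u]|.

Inductive sym := S0 | S1 | Sep | Blank.
Inductive move := MoveL | MoveR | Stay.

Record TM := {
  tm_state : finType;
  tm_start : tm_state;
  tm_halt  : tm_state -> option bool;   (* Some ans = halting state *)
  tm_delta : tm_state -> sym -> tm_state * sym * move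
}.

(* tape = (cells left of head, reversed; head cell; cells right of head) *)
Definition tape := (seq sym * sym * seq sym)%type.
Definition config (M : TM) := (tm_state M * tape)%type.

Definition move_tape (m : move) (T : tape) : tape :=
  let: (l, a, r) := T in
  match m with
  | Stay => T
  | MoveL => match l with [::] => ([::], Blank, a :: r)
                        | x :: l' => (l', x, a :: r) end
  | MoveR => match r with [::] => (a :: l, Blank, [::])
                        | x :: r' => (a :: l, x, r') end
  end.

Definition tm_step (M : TM) (c : config M) : config M :=
  let: (q, (l, a, r)) := c in
  match tm_halt q with
  | Some _ => c
  | None => let: (q', a', m) := tm_delta q a in (q', move_tape m (l, a', r))
  end.

Definition init_config (M : TM) (w : seq sym) : config M :=
  (tm_start M, ([::], head Blank w, behead w)).

Definition run (M : TM) (w : seq sym) (t : nat) : config M :=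
  iter t (@tm_step M) (init_config M w).

Definition halted_with (M : TM) (w : seq sym) (t : nat) (ans : bool) : Prop :=
  tm_halt (run M w t).1 = Some ans.

Fixpoint upto_blank (u : seq sym) : seq sym :=
  match u with
  | [::] => [::]
  | Blank :: _ => [::]
  | x :: u' => x :: upto_blank u'
  end.

Definition output (M : TM) (c : config M) : seq sym :=
  let: (_, (_, a, r)) := c in upto_blank (a :: r).

Definition computable2 (f : nat -> nat -> nat) : Prop :=
  exists M : TM, forall x y, exists t ans,
    let w := nseq x S1 ++ Sep :: nseq y S1 in
    halted_with M w t ans /\ output (run M w t) = nseq (f x y) S1.

Fixpoint pos_bits (p : positive) : seq sym :=
  match p with
  | xH => [:: S1]
  | xO p' => S0 :: pos_bits p'
  | xI p' => S1 :: pos_bits p'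
  end.

(* binary, least significant bit first; 0 is the empty word *)
Definition bin (m : nat) : seq sym :=
  match N.of_nat m with N0 => [::] | Npos p => pos_bits p end.

Definition encode (n : nat) (e : rel 'I_n) (s : 'I_n) (b k : nat) : seq sym :=
  nseq n S1 ++ Sep ::
  [seq (if e i j then S1 else S0) | i <- enum 'I_n, j <- enum 'I_n] ++ Sep ::
  nseq (nat_of_ord s) S1 ++ Sep :: bin b ++ Sep :: bin k.

(* Main.v *)
(* Instead of protecting vertices ahead of time, let every vertex on the fire
   line (unprotected, not burned, with a burned neighbour) be either saved or
   given up at the moment the fire reaches it, and only ask that at most [b * t]
   vertices are saved during the first [t] rounds; protecting the saved vertices
   in the order in which the fire reaches them then turns such a play into a
   strategy, and conversely a strategy can be replayed lazily.  A play is
   described by one bit for each vertex that ever gets on the fire line.  These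
   vertices are neighbours of the at most [k] burned ones, so [k * maxdeg e] bits
   suffice and all [2 ^ (k * maxdeg e)] words can be tried, each in polynomial
   time.  The budgets may be cut down to [n] first, which gives them short unary
   representations.  The algorithm is a structured program on stacks of booleans.
   A single-tape machine stores the stacks one after the other, separated by
   [Sep] (the format of the input words), and simulates a stack operation by a
   constant number of sweeps over the tape, which squares the running time. *)

Require Import Defs.
From Stdlib Require Import BinNat BinPos.
From mathcomp Require Import all_boot zify.
Set Implicit Arguments.
Unset Strict Implicit.
Unset Printing Implicit Defensive.

(** * Stack programs and their compilation to Turing machines *)

(** A strategy may protect vertices far away from the fire, so its moves cannot be enumerated within
    a bound that depends on [k] and the degree alone. Charging a protection only when the fire
    arrives makes the choices local. The budget must then be cumulative, because a protection spent
    early may pay for a vertex that is reached late; protections of vertices that the fire never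
    reaches are dropped, which is harmless since the budgets are only upper bounds. Plays that
    overspend are not aborted. Their excess is counted, so every play has the same [n] rounds and is
    a total function of the word, and a word that is too short is read as if it continued with
    [false]. The time bound also needs a machine that computes its factor. The compiler therefore
    leaves its result on the last stack, which can be read as a verdict or as an output, and one
    correctness theorem covers both machines. The intermediate semantics carries explicit costs, so
    that the tape is out of sight once [machineP] is proved. *)

Definition store := seq (seq bool).

Inductive cmd :=
| Skip
| Push of nat & bool
| Drop of nat
| Seq of cmd & cmd
| If of nat & cmd & cmd & cmd
| While of nat & cmd & cmd.

Notation stk := (nth [::]).
Notation upd := (set_nth [::]).

Inductive exec : cmd -> store -> store -> nat -> Prop :=
| E_Skip s : exec Skip s s 1
| E_Push i b s : exec (Push i b) s (upd s i (b :: (stk s i))) 1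
| E_Drop i s b l : stk s i = b :: l -> exec (Drop i) s (upd s i l) 1
| E_Seq c1 c2 s1 s2 s3 t1 t2 :
    exec c1 s1 s2 t1 -> exec c2 s2 s3 t2 -> exec (Seq c1 c2) s1 s3 (t1 + t2)
| E_If i c0 c1 c2 s s' t :
    exec (if (stk s i) is b :: _ then if b then c1 else c2 else c0) s s' t ->
    exec (If i c0 c1 c2) s s' t.+1
| E_WhileEnd i c1 c2 s : (stk s i) = [::] -> exec (While i c1 c2) s s 1
| E_While i c1 c2 b l s s1 s2 t1 t2 :
    (stk s i) = b :: l -> exec (if b then c1 else c2) s s1 t1 ->
    exec (While i c1 c2) s1 s2 t2 -> exec (While i c1 c2) s s2 (t1 + t2).+1.

Fixpoint uses_below (r : nat) (c : cmd) : bool :=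
  match c with
  | Skip => true
  | Push i _ | Drop i => i < r
  | Seq c1 c2 => uses_below r c1 && uses_below r c2
  | If i c0 c1 c2 =>
      [&& i < r, uses_below r c0, uses_below r c1 & uses_below r c2]
  | While i c1 c2 => [&& i < r, uses_below r c1 & uses_below r c2]
  end.

(** * Stores as tape contents *)

Definition bsym (b : bool) : sym := if b then S1 else S0.
Definition bsyms := map bsym.
Definition nonblank (a : sym) : bool := if a is Blank then false else true.

Definition before (p : nat) (s : store) : seq sym :=
  flatten [seq rcons (bsyms x) Sep | x <- take p s].
Definition after (p : nat) (s : store) : seq sym :=
  flatten [seq Sep :: bsyms x | x <- drop p.+1 s].
Definition content (s : store) : seq sym := bsyms (stk s 0) ++ after 0 s.

Lemma content_cons x (s : store) :
  0 < size s -> content (x :: s) = rcons (bsyms x) Sep ++ content s.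
Proof. by case: s => // y s _; rewrite /content /after /= !drop0 cat_rcons. Qed.

Lemma content_set p (s : store) y :
  p < size s -> content (upd s p y) = before p s ++ bsyms y ++ after p s.
Proof.
elim: p s => [|p IH] [|x s] //=.
rewrite ltnS => ps; rewrite content_cons; last by rewrite size_set_nth leq_max.
by rewrite IH // catA.
Qed.

Lemma content_split p (s : store) :
  p < size s -> content s = before p s ++ bsyms (stk s p) ++ after p s.
Proof.
move=> ps; rewrite -content_set //; congr content; apply: (@eq_from_nth _ [::]).
  by rewrite size_set_nth; apply/esym/maxn_idPr.
by move=> i _; rewrite nth_set_nth /=; case: eqP => [->|].
Qed.

Lemma nonblank_bsyms x : all nonblank (bsyms x).
Proof. by elim: x => //= -[]. Qed.

Lemma nonblank_before p s : all nonblank (before p s).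
Proof.
rewrite /before; elim: (take p s) => //= x l IH.
by rewrite all_cat all_rcons /= nonblank_bsyms.
Qed.

Lemma nonblank_after p s : all nonblank (after p s).
Proof.
rewrite /after; elim: (drop p.+1 s) => //= x l IH.
by rewrite all_cat /= nonblank_bsyms.
Qed.

Lemma nonblank_content s : all nonblank (content s).
Proof. by rewrite all_cat nonblank_bsyms nonblank_after. Qed.

(* Row of a transition table: the head symbol determines the next address, the
   symbol written and the move.  A machine whose address lies outside the table
   is stuck. *)
Definition row := sym -> nat * sym * move.

Definition row_step (rw : row) (T : tape) : nat * tape :=
  let: (l, a, r) := T in
  let: (pc, a', m) := rw a in (pc, move_tape m (l, a', r)).

Definition code_step (code : seq row) (c : nat * tape) : nat * tape :=
  if onth code c.1 is Some rw then row_step rw c.2 else c.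

Definition reaches (code : seq row) (c c' : nat * tape) (bound : nat) : Prop :=
  exists2 t, t <= bound & iter t (code_step code) c = c'.

Lemma reaches_refl code c : reaches code c c 0.
Proof. by exists 0. Qed.

Lemma reaches_trans code c1 c2 c3 m n :
  reaches code c1 c2 m -> reaches code c2 c3 n -> reaches code c1 c3 (m + n).
Proof.
move=> [t1 h1 <-] [t2 h2 <-]; exists (t2 + t1); first by rewrite addnC leq_add.
by rewrite iterD.
Qed.

Lemma reaches_weak code c c' m n : m <= n -> reaches code c c' m -> reaches code c c' n.
Proof. by move=> mn [t h <-]; exists t => //; exact: leq_trans mn. Qed.

Lemma reaches_step code pc T rw c' n :
  onth code pc = Some rw -> reaches code (row_step rw T) c' n ->
  reaches code (pc, T) c' n.+1.
Proof.
move=> h [t tn <-]; exists t.+1 => //; rewrite iterSr; congr (iter t _ _).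
by rewrite /code_step h.
Qed.

Arguments onth : simpl never.

Fixpoint placed (code : seq row) (o : nat) (rows : seq row) : Prop :=
  if rows is rw :: rows' then onth code o = Some rw /\ placed code o.+1 rows'
  else True.

Lemma placed_cat code o r1 r2 :
  placed code o (r1 ++ r2) <-> placed code o r1 /\ placed code (o + size r1) r2.
Proof.
elim: r1 o => [|x r1 IH] o /=; first by rewrite addn0; tauto.
by rewrite addnS -addSn; move: (IH o.+1); tauto.
Qed.

Lemma placed_refl code : placed code 0 code.
Proof.
suff: forall pre, placed (pre ++ code) (size pre) code by move/(_ [::]).
elim: code => //= x code IH pre; split; last by rewrite -cat_rcons -(size_rcons pre x).
by elim: pre.
Qed.

(** * Sweeps to the left end and to a given stack *)

Definition tape_at (l u : seq sym) : tape := (l, head Blank u, behead u).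

Notation blanks i := (nseq i Blank).

Definition home_row (h k : nat) : row :=
  fun a => if a is Blank then (k, Blank, MoveR) else (h, a, MoveL).

(** The left end is recognised by a blank, which is either one of the [i] blanks present or created
    by moving off the list; this explains [i.-1.+1]. It is also the reason why [tape_of] fixes a
    tape only up to the blanks around the content. *)
Lemma home_rowP code h k c i a r :
  onth code h = Some (home_row h k) -> all nonblank c ->
  reaches code (h, move_tape MoveL (c ++ blanks i, a, r))
               (k, tape_at (blanks i.-1.+1) (rev c ++ a :: r)) (size c).+1.
Proof.
move=> hh; elim: c a r => [|x c IH] a r /=.
  move=> _; case: i => [|i] /=.
    by apply: reaches_step hh _ => /=; apply: reaches_refl.
  by apply: reaches_step hh _ => /=; apply: reaches_refl.
case/andP => nx nc; rewrite rev_cons cat_rcons.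
by apply: reaches_step hh _ => /=; case: x nx => //= _; apply: IH.
Qed.

Definition seek_row (o : nat) : row :=
  fun a => if a is Sep then (o.+1, a, MoveR) else (o, a, MoveR).

Fixpoint seek (o p : nat) : seq row :=
  if p is p'.+1 then seek_row o :: seek o.+1 p' else [::].

Lemma size_seek o p : size (seek o p) = p.
Proof. by elim: p o => //= p IH o; rewrite IH. Qed.

Lemma move_right l a u : move_tape MoveR (l, a, u) = tape_at (a :: l) u.
Proof. by case: u. Qed.

Lemma seek_rowP code o l x u :
  onth code o = Some (seek_row o) ->
  reaches code (o, tape_at l (bsyms x ++ Sep :: u))
               (o.+1, tape_at (rev (rcons (bsyms x) Sep) ++ l) u) (size x).+1.
Proof.
move=> ho; elim: x l => [|b x IH] l /=.
  by apply: reaches_step ho _ => /=; rewrite -move_right; apply: reaches_refl.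
apply: reaches_step ho _ => /=; rewrite rev_cons cat_rcons.
have -> : (let: (pc, a', m) := seek_row o (bsym b) in
    (pc, move_tape m (l, a', bsyms x ++ Sep :: u))) =
    (o, tape_at (bsym b :: l) (bsyms x ++ Sep :: u)).
  by rewrite -move_right; case: b.
exact: IH.
Qed.

Lemma seekP code o p l (s : store) v :
  placed code o (seek o p) -> p < size s ->
  reaches code (o, tape_at l (content s ++ v))
    (o + p, tape_at (rev (before p s) ++ l) ((bsyms (stk s p) ++ after p s) ++ v))
    (size (before p s)).
Proof.
elim: p o l s => [|p IH] o l s /=.
  move=> _ ps; rewrite addn0 (content_split ps) /before take0 /=.
  exact: reaches_refl.
case: s => //= x s [ho hp]; rewrite ltnS => ps.
have -> : before p.+1 (x :: s) = rcons (bsyms x) Sep ++ before p s by [].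
have -> : content (x :: s) = bsyms x ++ Sep :: content s.
  by rewrite content_cons ?cat_rcons //; apply: leq_ltn_trans ps.
have -> : after p.+1 (x :: s) = after p s by [].
rewrite -(catA (bsyms x)) size_cat size_rcons size_map rev_cat -catA.
apply: reaches_trans; first exact: seek_rowP ho.
by rewrite addnS -addSn; apply: IH.
Qed.

Definition tape_of (s : store) (T : tape) : Prop :=
  exists i j, T = tape_at (blanks i) (content s ++ blanks j).

Lemma tape_ofI code h k c i a r s j :
  onth code h = Some (home_row h k) -> all nonblank c ->
  rev c ++ a :: r = content s ++ blanks j ->
  exists2 T, tape_of s T &
    reaches code (h, move_tape MoveL (c ++ blanks i, a, r)) (k, T) (size c).+1.
Proof.
move=> hh nc e; exists (tape_at (blanks i.-1.+1) (rev c ++ a :: r)).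
  by rewrite e; exists i.-1.+1, j.
exact: home_rowP.
Qed.

(** * Push, drop and test as sweeps *)

Definition sym_code (a : sym) : nat :=
  match a with S0 => 0 | S1 => 1 | _ => 2 end.

(** Insertion by shifting right: the address remembers the symbol in hand, which is written over the
    next one while that one is picked up. A blank ends the sweep and is never carried, so three such
    rows suffice and [sym_code] need not separate [Blank] from [Sep]. *)
Definition carry_row (q g : nat) (c : sym) : row :=
  fun a => if a is Blank then (g, c, MoveR) else (q + sym_code a, c, MoveR).

Definition const_row (rw : nat * move) : row := fun a => (rw.1, a, rw.2).

Lemma const_right k l y v :
  row_step (const_row (k, MoveR)) (tape_at l (y :: v)) = (k, tape_at (y :: l) v).
Proof. by rewrite -move_right. Qed.

Definition push_code (o k i : nat) (b : bool) : seq row :=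
  let q := (o + i).+1 in
  seek o i ++ [:: const_row (q + sym_code (bsym b), Stay);
                  carry_row q (q + 3) S0; carry_row q (q + 3) S1;
                  carry_row q (q + 3) Sep;
                  const_row (q + 4, MoveL); home_row (q + 4) k].

Lemma carryP code q g c l u j :
  (forall a, nonblank a -> onth code (q + sym_code a) = Some (carry_row q g a)) ->
  nonblank c -> all nonblank u ->
  reaches code (q + sym_code c, tape_at l (u ++ blanks j))
               (g, tape_at (rev (c :: u) ++ l) (blanks j.-1)) (size u).+1.
Proof.
move=> hq; elim: u c l => [|x u IH] c l nc /=.
  move=> _; apply: reaches_step (hq _ nc) _ => /=.
  by case: j => [|j] /=; rewrite -?move_right; apply: reaches_refl.
case/andP => nx nu; rewrite rev_cons cat_rcons.
apply: reaches_step (hq _ nc) _.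
have -> : row_step (carry_row q g c) (tape_at l (x :: u ++ blanks j)) =
          (q + sym_code x, tape_at (c :: l) (u ++ blanks j)).
  by rewrite -move_right; case: x nx.
exact: IH.
Qed.

Lemma push_codeP code o k i b s T :
  placed code o (push_code o k i b) -> i < size s -> tape_of s T ->
  exists2 T', tape_of (upd s i (b :: (stk s i))) T' &
    reaches code (o, T) (k, T') (6 * (size (content s) + 2)).
Proof.
rewrite /push_code; set q := (o + i).+1.
move=> /placed_cat[hs]; rewrite size_seek /= -/q.
move=> [h0 [h1 [h2 [h3 [h4 [h5 _]]]]]] si [i0 [j ->]].
have {}h5 : onth code (q + 4) = Some (home_row (q + 4) k) by rewrite {1}addn4.
have hq a : nonblank a -> onth code (q + sym_code a) = Some (carry_row q (q + 3) a).
  by case: a => //= _; rewrite ?addn0 ?addn1 ?addn2.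
set u := bsyms (stk s i) ++ after i s.
have nu : all nonblank u by rewrite all_cat nonblank_bsyms nonblank_after.
have nb : nonblank (bsym b) by case: (b).
pose c := rev (before i s ++ bsym b :: u).
have ec : rev (bsym b :: u) ++ rev (before i s) ++ blanks i0 = c ++ blanks i0.
  by rewrite catA -rev_cat.
have nc : all nonblank c.
  by rewrite all_rev all_cat nonblank_before /= nb nu.
have [T' hT hr] := @tape_ofI code (q + 4) k c i0 Blank
   (blanks j.-1.-1) (upd s i (b :: (stk s i))) j.-1.-1.+1
   h5 nc
   (ltac:(by rewrite revK content_set //= -catA)).
exists T' => //.
have hsz : size (content s) = size (before i s) + size u.
  by rewrite (content_split si) size_cat.
have hc : size c = (size (content s)).+1.
  by rewrite size_rev size_cat /= hsz addnS.
apply: (@reaches_weak _ _ _ (size (before i s) + (1 + ((size u).+1 + (1 + (size c).+1))))).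
  rewrite hc; lia.
apply: reaches_trans; first exact: seekP.
apply: reaches_trans.
  by apply: reaches_step h0 _ => /=; apply: reaches_refl.
apply: reaches_trans.
  rewrite -/u; exact: (carryP (g := q + 3) _ _ hq nb nu).
rewrite ec; apply: reaches_trans hr.
apply: (reaches_step (rw := const_row (q + 4, MoveL))); first by rewrite addn3.
by case: (j.-1) => [|j']; apply: reaches_refl.
Qed.

Definition shift_row (q : nat) : row :=
  fun a => if a is Blank then (q + 5, Blank, MoveL) else (q + 2 + sym_code a, a, MoveL).

Definition write_row (k : nat) (c : sym) (m : move) : row := fun _ => (k, c, m).

(** Deletion by shifting left: each symbol costs a step right to read it, a step left, and a step
    that writes it and returns to the right. The last occupied cell is then stale and gets
    erased. *)
Definition drop_code (o k i : nat) : seq row :=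
  let q := o + i in
  seek o i ++ [:: const_row (q + 1, MoveR); shift_row q;
                  write_row q S0 MoveR; write_row q S1 MoveR; write_row q Sep MoveR;
                  write_row (q + 6) Blank MoveL; home_row (q + 6) k].

Lemma shiftP code q l y u j :
  onth code q = Some (const_row (q + 1, MoveR)) ->
  onth code (q + 1) = Some (shift_row q) ->
  (forall a, nonblank a -> onth code (q + 2 + sym_code a) = Some (write_row q a MoveR)) ->
  all nonblank u ->
  exists y' j', reaches code (q, tape_at l (y :: u ++ blanks j))
                 (q + 5, tape_at (rev u ++ l) (y' :: blanks j')) (3 * (size u).+1).
Proof.
move=> h0 h1 h2; elim: u l y => [|x u IH] l y /=.
  move=> _; exists y, (j.-1.+1); rewrite -[3 * 1]/3.
  apply: (@reaches_weak _ _ _ 2) => //.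
  apply: reaches_step h0 _; rewrite const_right.
  by apply: reaches_step h1 _; case: j => [|j] /=; apply: reaches_refl.
case/andP => nx nu.
have [y' [j' IH']] := IH (x :: l) x nu; exists y', j'.
rewrite rev_cons cat_rcons mulnS.
apply: reaches_trans IH'.
apply: reaches_step h0 _; rewrite const_right; apply: reaches_step h1 _.
have -> : row_step (shift_row q) (tape_at (y :: l) (x :: u ++ blanks j)) =
          (q + 2 + sym_code x, (l, y, x :: u ++ blanks j)) by case: (x) nx.
by apply: reaches_step (h2 _ nx) _ => /=; apply: reaches_refl.
Qed.

Lemma size_after0 (s : store) : 1 < size s -> 0 < size (after 0 s).
Proof. by case: s => [|x [|y s]]. Qed.

Lemma size_before (s : store) i : 0 < i -> i < size s -> 0 < size (before i s).
Proof. by case: i s => [|i] [|x s] //=; rewrite /before /= !size_cat size_rcons. Qed.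

Lemma drop_codeP code o k i s T b x :
  placed code o (drop_code o k i) -> i < size s -> 1 < size s ->
  (stk s i) = b :: x -> tape_of s T ->
  exists2 T', tape_of (upd s i x) T' &
    reaches code (o, T) (k, T') (6 * (size (content s) + 2)).
Proof.
rewrite /drop_code; set q := o + i.
move=> /placed_cat[hs]; rewrite size_seek -/q /=.
move=> [h0 [h1 [h2 [h3 [h4 [h5 [h6 _]]]]]]] si s1 eb [i0 [j ->]].
rewrite -addn1 in h1.
have {}h5 : onth code (q + 5) = Some (write_row (q + 6) Blank MoveL).
  by rewrite -h5; congr onth; lia.
have {}h6 : onth code (q + 6) = Some (home_row (q + 6) k).
  by rewrite -h6; congr onth; lia.
have hq a : nonblank a -> onth code (q + 2 + sym_code a) = Some (write_row q a MoveR).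
  by case: a => //= _; rewrite ?addn0 ?addn1 ?addn2.
set u := bsyms x ++ after i s.
have nu : all nonblank u by rewrite all_cat nonblank_bsyms nonblank_after.
have [y' [j' hsh]] := @shiftP code q (rev (before i s) ++ blanks i0) (bsym b) u j
   h0 h1 hq nu.
have nc : all nonblank (before i s ++ u) by rewrite all_cat nonblank_before.
have : 0 < size (before i s ++ u).
  rewrite !size_cat; case: (posnP i) => [i0E|i_gt0]; last by have := size_before i_gt0 si; lia.
  rewrite i0E; by have := size_after0 s1; lia.
have hsz : size (content s) = size (before i s) + (size u).+1.
  by rewrite (content_split si) eb size_cat.
have hc : size (before i s ++ u) <= size (content s) by rewrite size_cat hsz; lia.
case/lastP E : (before i s ++ u) => [//|c z] _.
rewrite E all_rcons in nc; case/andP: nc => nz nc.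
rewrite E size_rcons in hc.
have [T' hT hr] := @tape_ofI code (q + 6) k (z :: rev c) i0 Blank (blanks j') (upd s i x) j'.+1
   h6 (ltac:(by rewrite /= nz all_rev))
   (ltac:(by rewrite rev_cons revK content_set // -/u E)).
exists T' => //.
apply: (@reaches_weak _ _ _ (size (before i s) + (3 * (size u).+1 + (1 + (size c).+2)))).
  lia.
apply: reaches_trans; first exact: seekP.
apply: reaches_trans; first by rewrite eb; exact: hsh.
have -> : rev u ++ rev (before i s) ++ blanks i0 = (z :: rev c) ++ blanks i0.
  by rewrite catA -rev_cat E rev_rcons.
rewrite -[(size c).+2]/((size c).+1.+1) -(size_rev c).
apply: reaches_trans hr.
apply: (reaches_step h5).
exact: reaches_refl.
Qed.

Definition test_row (q : nat) : row :=
  fun a => match a with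
           | S0 => (q + 2, a, MoveL) | S1 => (q + 1, a, MoveL) | _ => (q, a, MoveL)
           end.

(** The homing rows differ only in their continuation, so the address keeps the outcome of the test
    during the way back. Reading a separator or a blank means that the stack is empty. *)
Definition peek_code (o i k0 k1 k2 : nat) : seq row :=
  let q := (o + i).+1 in
  seek o i ++ [:: test_row q; home_row q k0; home_row (q + 1) k1; home_row (q + 2) k2].

Lemma peek_codeP code o i k0 k1 k2 s T :
  placed code o (peek_code o i k0 k1 k2) -> i < size s -> tape_of s T ->
  exists2 T', tape_of s T' &
    reaches code (o, T) (if (stk s i) is b :: _ then if b then k1 else k2 else k0, T')
      (6 * (size (content s) + 2)).
Proof.
rewrite /peek_code; set q := (o + i).+1.
move=> /placed_cat[hs]; rewrite size_seek /= -/q.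
move=> [h0 [h1 [h2 [h3 _]]]] si [i0 [j ->]].
set k := (if (stk s i) is b :: _ then _ else _).
pose h := if (stk s i) is b :: _ then if b then q + 1 else q + 2 else q.
rewrite -addn1 in h2; rewrite -addn2 in h3.
have hh : onth code h = Some (home_row h k) by rewrite /h /k; case: (stk s i) => [|[] l].
set u := bsyms (stk s i) ++ after i s.
(* If the tested stack is the last one and empty, the head may stand beyond the listed cells, and
   reading there adds one blank. *)
have [j' ej] : exists j', head Blank (u ++ blanks j) :: behead (u ++ blanks j) = u ++ blanks j'.
  by case: (u) => [|a u']; [exists j.-1.+1; case: (j) | exists j].
have [T' hT hr] := @tape_ofI code h k (rev (before i s)) i0 (head Blank (u ++ blanks j))
   (behead (u ++ blanks j)) s j' hh (ltac:(by rewrite all_rev nonblank_before))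
   (ltac:(by rewrite revK ej catA -content_split)).
have hc := content_split si.
exists T' => //.
apply: (@reaches_weak _ _ _ (size (before i s) + (size (rev (before i s))).+2)).
  by rewrite size_rev hc size_cat; lia.
apply: reaches_trans; first exact: seekP.
apply: (reaches_step h0); rewrite -/u.
have -> // : row_step (test_row q) (tape_at (rev (before i s) ++ blanks i0) (u ++ blanks j)) =
   (h, move_tape MoveL (rev (before i s) ++ blanks i0, head Blank (u ++ blanks j),
                         behead (u ++ blanks j))).
rewrite /h /u; case: (stk s i) => [|[] l] //=.
by rewrite /after; case: (drop i.+1 s) => //=; case: (j).
Qed.

(** * Compilation *)

Fixpoint code_size (c : cmd) : nat :=
  match c with
  | Skip => 1
  | Push i _ => i + 6
  | Drop i => i + 7
  | Seq c1 c2 => code_size c1 + code_size c2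
  | If i c0 c1 c2 => i + 4 + code_size c0 + code_size c1 + code_size c2
  | While i c1 c2 => i + 4 + code_size c1 + code_size c2
  end.

(** [o] is the address where the code is placed and [k] the address to which it hands over control;
    loop bodies hand over to the test at [o]. *)
Fixpoint compile (c : cmd) (o k : nat) : seq row :=
  match c with
  | Skip => [:: const_row (k, Stay)]
  | Push i b => push_code o k i b
  | Drop i => drop_code o k i
  | Seq c1 c2 => compile c1 o (o + code_size c1) ++ compile c2 (o + code_size c1) k
  | If i c0 c1 c2 =>
      let o0 := o + (i + 4) in
      let o1 := o0 + code_size c0 in
      let o2 := o1 + code_size c1 in
      peek_code o i o0 o1 o2 ++ compile c0 o0 k ++ compile c1 o1 k ++ compile c2 o2 k
  | While i c1 c2 =>
      let o1 := o + (i + 4) in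
      let o2 := o1 + code_size c1 in
      peek_code o i k o1 o2 ++ compile c1 o1 o ++ compile c2 o2 o
  end.

Lemma size_peek_code o i k0 k1 k2 : size (peek_code o i k0 k1 k2) = i + 4.
Proof. by rewrite size_cat size_seek. Qed.

Lemma size_compile c o k : size (compile c o k) = code_size c.
Proof.
elim: c o k => //= [i b|i|c1 IH1 c2 IH2|i c0 IH0 c1 IH1 c2 IH2|i c1 IH1 c2 IH2] o k.
- by rewrite size_cat size_seek.
- by rewrite size_cat size_seek.
- by rewrite size_cat IH1 IH2.
- by rewrite size_cat size_peek_code !size_cat IH0 IH1 IH2 !addnA.
- by rewrite size_cat size_peek_code !size_cat IH1 IH2 !addnA.
Qed.

Lemma size_content (s : store) i x :
  i < size s ->
  size (content (upd s i x)) + size (stk s i) = size (content s) + size x.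
Proof.
move=> si; rewrite content_set // (content_split si) !size_cat !size_map; lia.
Qed.

Lemma size_upd (s : store) i x : i < size s -> size (upd s i x) = size s.
Proof. by move=> si; rewrite size_set_nth; apply/maxn_idPr. Qed.

Lemma exec_size c s s' t :
  exec c s s' t -> uses_below (size s) c ->
  size s' = size s /\ size (content s') <= size (content s) + t.
Proof.
elim=> {c s s' t} //=.
- by move=> s _; split=> //; lia.
- move=> i b s si; rewrite size_upd //; split=> //.
  have /= := size_content (b :: stk s i) si; lia.
- move=> i s b l e si; rewrite size_upd //; split=> //.
  have /= := size_content l si; rewrite e /=; lia.
- move=> c1 c2 s1 s2 s3 t1 t2 _ IH1 _ IH2 /andP[u1 u2].
  have [e1 l1] := IH1 u1; rewrite -e1 in u2.
  by have [e2 l2] := IH2 u2; rewrite e2 e1; split=> //; lia.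
- move=> i c0 c1 c2 s s' t _ IH /and4P[_ u0 u1 u2].
  have [|e l] := IH; first by case: (stk s i) => [|[]].
  by split=> //; lia.
- by move=> i c1 c2 s _ _; split=> //; lia.
- move=> i c1 c2 b l s s1 s2 t1 t2 _ _ IH1 _ IH2 /and3P[u0 u1 u2].
  have [|e1 l1] := IH1; first by case: b {IH1}.
  rewrite e1 u0 u1 u2 in IH2; have [//|e2 l2] := IH2.
  by split=> //; lia.
Qed.

(** By [exec_size] a unit of time adds at most one symbol, so the tape never holds more than
    [size (content s) + t] symbols, and every unit of time is simulated by one sweep operation of
    linear length. *)
Lemma compileP code c s s' t :
  exec c s s' t -> forall o k T,
  placed code o (compile c o k) -> uses_below (size s) c -> 1 < size s -> tape_of s T ->
  exists2 T', tape_of s' T' &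
    reaches code (o, T) (k, T') (t * (6 * (size (content s) + t + 2))).
Proof.
elim=> {c s s' t} /=.
- move=> s o k T [h _] _ _ hT; exists T => //.
  apply: (@reaches_weak _ _ _ 1); first by lia.
  by apply: (reaches_step h); case: T {hT} => [[l a] r]; exact: reaches_refl.
- move=> i b s o k T hp si s1 hT.
  have [T' hT' hr] := push_codeP hp si hT; exists T' => //.
  by apply: reaches_weak hr; lia.
- move=> i s b l e o k T hp si s1 hT.
  have [T' hT' hr] := drop_codeP hp si s1 e hT; exists T' => //.
  by apply: reaches_weak hr; lia.
- move=> c1 c2 s1 s2 s3 t1 t2 h1 IH1 h2 IH2 o k T /placed_cat[p1].
  rewrite size_compile => p2 /andP[u1 u2] sz hT.
  have [e1 l1] := exec_size h1 u1.
  have [T1 hT1 r1] := IH1 _ _ _ p1 u1 sz hT.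
  rewrite -e1 in u2 sz.
  have [T2 hT2 r2] := IH2 _ _ _ p2 u2 sz hT1.
  exists T2 => //; apply: reaches_weak (reaches_trans r1 r2).
  rewrite mulnDl leq_add // leq_mul2l leq_mul2l; lia.
- move=> i c0 c1 c2 s s' t h IH o k T /placed_cat[pp].
  rewrite size_peek_code => /placed_cat[p0]; rewrite size_compile => /placed_cat[p1].
  rewrite size_compile => p2 /and4P[si u0 u1 u2] sz hT.
  have [T1 hT1 r1] := peek_codeP pp si hT.
  move: r1; set o' := (X in (X, T1)) => r1.
  have [||T2 hT2 r2] := IH o' k T1 _ _ sz hT1.
  + by rewrite /o'; case: (stk s i) => [|[]].
  + by case: (stk s i) => [|[]].
  exists T2 => //; apply: reaches_weak (reaches_trans r1 r2).
  rewrite mulSn leq_add //; first by lia.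
  rewrite leq_mul2l leq_mul2l; lia.
- move=> i c1 c2 s e o k T /placed_cat[pp _] /and3P[si _ _] sz hT.
  have [T1 hT1] := peek_codeP pp si hT; rewrite e => r1.
  by exists T1 => //; apply: reaches_weak r1; lia.
- move=> i c1 c2 b l s s1 s2 t1 t2 e h1 IH1 h2 IH2 o k T pw uw sz hT.
  have /placed_cat[pp] := pw.
  rewrite size_peek_code => /placed_cat[p1]; rewrite size_compile => p2.
  have /and3P[si u1 u2] := uw.
  have [T1 hT1] := peek_codeP pp si hT; rewrite e => r1.
  have ub : uses_below (size s) (if b then c1 else c2) by case: (b).
  have [e1 l1] := exec_size h1 ub.
  have [|T2 hT2 r2] := IH1 (if b then o + (i + 4) else o + (i + 4) + code_size c1) o _ _ ub sz hT1.
    by case: (b).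
  rewrite -e1 in uw sz.
  have [T3 hT3 r3] := IH2 _ _ _ pw uw sz hT2.
  exists T3 => //; apply: reaches_weak (reaches_trans r1 (reaches_trans r2 r3)).
  rewrite [(t1 + t2).+1 * _]mulSn mulnDl; apply: leq_add; first by lia.
  by apply: leq_add; rewrite leq_mul2l leq_mul2l; lia.
Qed.

(** * Start-up, answer and the resulting machine *)

Definition init_code (d : nat) : seq row :=
  (fun a => if a is Blank then (1, a, Stay) else (0, a, MoveR)) ::
  [seq write_row j.+2 Sep MoveR | j <- iota 0 d] ++
  [:: const_row (d + 2, MoveL); home_row (d + 2) (d + 3)].

Lemma content_pad (s : store) d :
  0 < size s -> content (s ++ nseq d [::]) = content s ++ nseq d Sep.
Proof.
case: s => //= x s _; rewrite /content /after /= !drop0 -catA map_cat flatten_cat.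
by rewrite map_nseq; congr (_ ++ (_ ++ _)); elim: d => //= d ->.
Qed.

Lemma init_codeP code d (s : store) :
  placed code 0 (init_code d) -> 0 < size s ->
  exists2 T, tape_of (s ++ nseq d [::]) T &
    reaches code (0, tape_at [::] (content s)) (d + 3, T) (2 * (size (content s) + d + 2)).
Proof.
move=> [h0 /placed_cat[hw]]; rewrite size_map size_iota /= => -[h1 [h2 _]] s0.
have scan l u : all nonblank u ->
  reaches code (0, tape_at l u) (1, tape_at (rev u ++ l) [:: Blank]) (size u).+1.
  elim: u l => [|a u IH] l /=.
    by move=> _; apply: (reaches_step h0); exact: reaches_refl.
  case/andP=> na nu; apply: (reaches_step h0); rewrite rev_cons cat_rcons.
  by case: a na => //= _; rewrite -/(move_tape MoveR (_, _, u)) move_right; exact: IH.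
have writes k i l m : placed code i.+1 [seq write_row j.+2 Sep MoveR | j <- iota i k] ->
  reaches code (i.+1, tape_at l (blanks m))
    ((i + k).+1, tape_at (nseq k Sep ++ l) (blanks (m - k))) k.
  elim: k i l m => [|k IH] i l m /=; first by rewrite addn0 subn0 => _; exact: reaches_refl.
  move=> [hi hs]; apply: (reaches_step hi).
  have -> : row_step (write_row i.+2 Sep MoveR) (tape_at l (blanks m)) =
            (i.+2, tape_at (Sep :: l) (blanks m.-1)).
    by rewrite -move_right; case: (m).
  have -> : Sep :: nseq k Sep ++ l = nseq k Sep ++ Sep :: l by elim: (k) => //= k' ->.
  have -> : m - k.+1 = m.-1 - k by lia.
  by rewrite -addSnnS; exact: IH.
pose c := nseq d Sep ++ rev (content s).
have nc : all nonblank c.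
  by rewrite all_cat all_rev nonblank_content andbT; elim: (d).
have {}h1 : onth code d.+1 = Some (const_row (d + 2, MoveL)).
  by rewrite -h1; congr onth; lia.
have {}h2 : onth code (d + 2) = Some (home_row (d + 2) (d + 3)).
  by rewrite -h2; congr onth; lia.
have [T hT hr] := @tape_ofI code (d + 2) (d + 3) c 0 Blank (behead (blanks (1 - d)))
  (s ++ nseq d [::]) (1 - d).-1.+1 h2 nc
  (ltac:(by rewrite content_pad // rev_cat revK rev_nseq; case: (1 - d))).
exists T => //.
apply: (@reaches_weak _ _ _ ((size (content s)).+1 + (d + (size c).+2))).
  by rewrite /c size_cat size_nseq size_rev; lia.
apply: reaches_trans; first exact: scan (nonblank_content s).
apply: reaches_trans; first exact: (writes d 0 _ 1 hw).
rewrite add0n cats0 -/c; apply: (reaches_step h1).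
have -> // : row_step (const_row (d + 2, MoveL)) (tape_at c (blanks (1 - d))) =
  (d + 2, move_tape MoveL (c ++ blanks 0, Blank, behead (blanks (1 - d)))).
by rewrite cats0; case: (1 - d).
Qed.

(** In [program] both targets lie just past the end of the table, where [code_step] is stuck; they
    become the rejecting and the accepting state. *)
Definition answer_row (o : nat) : row := fun a => (if a is S1 then o.+1 else o, a, Stay).

Definition program (m r : nat) (c : cmd) : seq row :=
  let d := r - m in
  let o := d + 3 + code_size c in
  init_code d ++ compile c (d + 3) o ++ seek o r.-1 ++ [:: answer_row (o + r)].

Definition target (rw : row) (a : sym) : nat := (rw a).1.1.

Definition max_target (rw : row) : nat :=
  maxn (maxn (target rw S0) (target rw S1)) (maxn (target rw Sep) (target rw Blank)).

Lemma leq_max_target rw a : target rw a <= max_target rw.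
Proof. by case: a; rewrite !leq_max leqnn ?orbT. Qed.

(** Covers all jump targets and both halting addresses, so that [inord] in [machine] never falls
    back on its default value. *)
Definition address_bound (code : seq row) : nat :=
  maxn (size code).+1 (foldr maxn 0 (map max_target code)).

Lemma address_boundP code q rw a :
  onth code q = Some rw -> target rw a <= address_bound code.
Proof.
move=> h; rewrite leq_max; apply/orP; right.
apply: leq_trans (leq_max_target rw a) _.
elim: code q h => [|x code IH] [|q] //=; first by move=> [->]; rewrite leq_maxl.
by move=> /IH h; rewrite leq_max h orbT.
Qed.

Definition machine (m r : nat) (c : cmd) : TM :=
  let code := program m r c in
  {| tm_state := 'I_(address_bound code).+1;
     tm_start := ord0;
     tm_halt := fun q => if q == size code :> nat then Some false
                         else if q == (size code).+1 :> nat then Some true else None;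
     tm_delta := fun q a =>
       if onth code q is Some rw then let: (k, a', mv) := rw a in (inord k, a', mv)
       else (q, a, Stay) |}.

Lemma run_machine m r c w t :
  let: (q, T) := run (machine m r c) w t in
  iter t (code_step (program m r c)) (0, tape_at [::] w) = (val q, T).
Proof.
elim: t => [|t]; first by [].
have -> : run (machine m r c) w t.+1 = tm_step (run (machine m r c) w t) by [].
rewrite iterS; case: (run _ w t) => q [[l a] r'] -> /=.
rewrite /code_step /=.
have [qs|qs] := ltnP q (size (program m r c)).
  rewrite !ltn_eqF //; last exact: ltnW.
  case h : (onth _ q) => [rw|] /=; last by [].
  have := address_boundP a h; rewrite /target.
  by case: (rw a) => [[k a'] mv] /= hk; rewrite inordK.
rewrite onth_default //; case: eqP => // _; case: eqP => //.
Qed.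

(** The machine halts with its head at the start of the last stack: the top bit decides the halting
    state, and the symbols up to the first blank are exactly that stack. *)
Theorem machineP m r c s s' t :
  size s = m -> 0 < m <= r -> 1 < r -> uses_below r c ->
  exec c (s ++ nseq (r - m) [::]) s' t ->
  exists2 t', t' <= 20 * (t + 1) * (size (content s) + t + r + 2) &
    halted_with (machine m r c) (content s) t' (head false (stk s' r.-1)) /\
    output (run (machine m r c) (content s) t') = bsyms (stk s' r.-1).
Proof.
move=> sm /andP[m0 mr] r1 uc ex; set d := r - m in ex.
have sr : size (s ++ nseq d [::]) = r by rewrite size_cat size_nseq sm subnKC.
have := placed_refl (program m r c); rewrite {2}/program -/d.
set o := d + 3 + code_size c; set code := program m r c.
move=> /placed_cat[hi /placed_cat[hc /placed_cat[hs]]].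
have si : size (init_code d) = d + 3 by rewrite /= size_cat size_map size_iota /=; lia.
rewrite size_compile add0n si -/o size_seek => -[ha _].
rewrite add0n si in hc; rewrite size_compile add0n si -/o in hs.
have sz : size code = o + r.
  by rewrite !size_cat si size_compile size_seek /= -/d /o; lia.
have [|T1 hT1 h1] := init_codeP (s := s) hi; first by rewrite sm.
have [||T2 [i [j eT2]] h2] := compileP ex hc _ _ hT1; try by rewrite sr.
have [es' ls'] : size s' = r /\ size (content s') <= size (content (s ++ nseq d [::])) + t.
  by have := exec_size ex; rewrite sr => /(_ uc).
rewrite eT2 in h2.
have r's' : r.-1 < size s' by rewrite es'; lia.
have h3 := seekP (blanks i) (blanks j) hs r's'.
rewrite /after drop_oversize ?cats0 in h3; last by rewrite es'; lia.
set L := rev (before r.-1 s') ++ blanks i in h3.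
set u := bsyms (stk s' r.-1) ++ blanks j in h3.
have h4 : reaches code (o + r.-1, tape_at L u)
            (if head false (stk s' r.-1) then (o + r).+1 else o + r, tape_at L u) 1.
  apply: (reaches_step ha); rewrite /u; case: (stk s' r.-1) => [|[] l] /=.
  - by case: (j) => [|j']; exists 0 => //; case: j'.
  - by exists 0.
  - by exists 0.
have [t' lt' et'] := reaches_trans h1 (reaches_trans h2 (reaches_trans h3 h4)).
exists t'.
  apply: leq_trans lt' _.
  have lb : size (before r.-1 s') <= size (content s').
    by rewrite (content_split r's') size_cat leq_addr.
  have lc : size (content (s ++ nseq d [::])) = size (content s) + d.
    by rewrite content_pad ?sm // size_cat size_nseq.
  have ld : d <= r by rewrite leq_subr.
  nia.
have := run_machine m r c (content s) t'; rewrite /halted_with.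
case: (run _ _ t') => q T; rewrite -/code et' => -[eq eT]; split.
  have -> : tm_halt (q, T).1 = if val q == size code then Some false
                               else if val q == (size code).+1 then Some true else None by [].
  rewrite [val q]/= -eq sz.
  by case: (head false _); rewrite ?eqxx // eqn_leq ltnn.
rewrite -eT /output /u /=.
have : upto_blank (bsyms (stk s' r.-1) ++ blanks j) = bsyms (stk s' r.-1).
  by elim: (stk s' r.-1) => [|[] l /= ->] //; case: (j).
by case: (bsyms _ ++ blanks j).
Qed.

(** * Running times of stack programs *)

Definition runs (c : cmd) (s s' : store) (T : nat) : Prop :=
  exists2 t, t <= T & exec c s s' t.

Lemma runs_conv c s s1 s2 t1 t2 :
  runs c s s1 t1 -> s1 = s2 -> t1 <= t2 -> runs c s s2 t2.
Proof. by move=> [t ht h] <- h2; exists t => //; exact: leq_trans h2. Qed.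

Lemma runs_skip s : runs Skip s s 1.
Proof. by exists 1 => //; constructor. Qed.

Lemma runs_push i b s : runs (Push i b) s (upd s i (b :: stk s i)) 1.
Proof. by exists 1 => //; constructor. Qed.

Lemma runs_drop i b l s : stk s i = b :: l -> runs (Drop i) s (upd s i l) 1.
Proof. by move=> e; exists 1 => //; econstructor; exact: e. Qed.

Lemma runs_seq c1 c2 s1 s2 s3 t1 t2 :
  runs c1 s1 s2 t1 -> runs c2 s2 s3 t2 -> runs (Seq c1 c2) s1 s3 (t1 + t2).
Proof.
move=> [u1 h1 e1] [u2 h2 e2]; exists (u1 + u2); first exact: leq_add.
by econstructor; [exact: e1|exact: e2].
Qed.

Lemma runs_if i c0 c1 c2 s s' t :
  runs (if stk s i is b :: _ then if b then c1 else c2 else c0) s s' t ->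
  runs (If i c0 c1 c2) s s' t.+1.
Proof. by move=> [u h e]; exists u.+1 => //; constructor. Qed.

(** Every round pops a bit, so a loop consumes the stack that drives it; data needed later has to be
    rebuilt in a buffer by the body. *)
Definition Loop i c1 c2 := While i (Seq (Drop i) c1) (Seq (Drop i) c2).
Definition Case i c0 c1 c2 := If i c0 (Seq (Drop i) c1) (Seq (Drop i) c2).

Lemma runs_loop_nil i c1 c2 s : stk s i = [::] -> runs (Loop i c1 c2) s s 1.
Proof. by move=> e; exists 1 => //; apply: E_WhileEnd. Qed.

Lemma runs_loop_cons i c1 c2 b l s s1 s2 t1 t2 :
  stk s i = b :: l -> runs (if b then c1 else c2) (upd s i l) s1 t1 ->
  runs (Loop i c1 c2) s1 s2 t2 -> runs (Loop i c1 c2) s s2 (t1 + t2 + 2).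
Proof.
move=> e [u1 h1 e1] [u2 h2 e2]; exists (1 + u1 + u2).+1; first by lia.
apply: (E_While e _ e2).
by case: b e e1 => e e1; apply: E_Seq e1; apply: E_Drop e.
Qed.

Lemma runs_case_nil i c0 c1 c2 s s' t :
  stk s i = [::] -> runs c0 s s' t -> runs (Case i c0 c1 c2) s s' (t + 1).
Proof. by move=> e h; rewrite addn1; apply: runs_if; rewrite e. Qed.

Lemma runs_case_cons i c0 c1 c2 b l s s' t :
  stk s i = b :: l -> runs (if b then c1 else c2) (upd s i l) s' t ->
  runs (Case i c0 c1 c2) s s' (t + 2).
Proof.
move=> e h; rewrite addn2; apply: runs_if; rewrite e.
have := runs_seq (runs_drop e); rewrite -[t.+1]add1n.
by case: b e h => e h; apply.
Qed.

Definition move_stack i j := Loop i (Push j true) (Push j false).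

Definition move_stack2 i j k :=
  Loop i (Seq (Push j true) (Push k true)) (Seq (Push j false) (Push k false)).

Definition copy_stack i j tmp := Seq (move_stack i tmp) (move_stack2 tmp i j).

Definition clear_stack i := Loop i Skip Skip.

Lemma upd_upd (s : store) i x y : upd (upd s i x) i y = upd s i y.
Proof. by rewrite set_set_nth eqxx. Qed.

Lemma upd_updC (s : store) i j x y : i != j -> upd (upd s i x) j y = upd (upd s j y) i x.
Proof. by move=> ij; rewrite set_set_nth (negbTE ij). Qed.

Lemma stk_upd (s : store) i j x : stk (upd s i x) j = if j == i then x else stk s j.
Proof. by rewrite nth_set_nth. Qed.

Lemma upd_id (s : store) i : i < size s -> upd s i (stk s i) = s.
Proof.
move=> si; apply: (@eq_from_nth _ [::]); first by rewrite size_upd.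
by move=> j _; rewrite nth_set_nth /=; case: eqP => // ->.
Qed.

Lemma runs_move_stack i j s :
  i != j -> i < size s -> j < size s ->
  runs (move_stack i j) s (upd (upd s j (rev (stk s i) ++ stk s j)) i [::])
    (3 * size (stk s i) + 1).
Proof.
move=> ij; move e : (stk s i) => l; elim: l s e => [|b l IH] s e si sj.
  apply: (runs_conv (runs_loop_nil _ _ e)) => //.
  by have h := upd_id si; rewrite e in h; rewrite /= upd_id // h.
have hb : runs (if b then Push j true else Push j false) (upd s i l)
     (upd (upd s i l) j (b :: stk s j)) 1.
  have := runs_push j b (upd s i l); rewrite stk_upd eq_sym (negbTE ij).
  by case: b e.
apply: (runs_conv (runs_loop_cons e hb (IH _ _ _ _))).
- by rewrite !stk_upd eqxx (negbTE ij).
- by rewrite !size_upd.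
- by rewrite !size_upd.
- rewrite stk_upd eqxx upd_upd (upd_updC _ _ _ ij) upd_upd.
  by rewrite rev_cons cat_rcons.
- by rewrite /=; lia.
Qed.

Lemma runs_move_stack2 i j k s :
  i != j -> i != k -> j != k -> i < size s -> j < size s -> k < size s ->
  runs (move_stack2 i j k) s
    (upd (upd (upd s k (rev (stk s i) ++ stk s k)) j (rev (stk s i) ++ stk s j)) i [::])
    (4 * size (stk s i) + 1).
Proof.
move=> ij ik jk; move e : (stk s i) => l; elim: l s e => [|b l IH] s e si sj sk.
  apply: (runs_conv (runs_loop_nil _ _ e)) => //.
  have h := upd_id si; rewrite e in h.
  by rewrite /= (upd_id sk) (upd_id sj) h.
have hb : runs (if b then Seq (Push j true) (Push k true) else Seq (Push j false) (Push k false))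
     (upd s i l) (upd (upd (upd s i l) j (b :: stk s j)) k (b :: stk s k)) 2.
  have := runs_seq (runs_push j b (upd s i l)) (runs_push k b _).
  rewrite !stk_upd [j == i]eq_sym [k == j]eq_sym [k == i]eq_sym (negbTE ij) (negbTE ik) (negbTE jk).
  by case: b e.
apply: (runs_conv (runs_loop_cons e hb (IH _ _ _ _ _))).
- by rewrite !stk_upd eqxx (negbTE ij) (negbTE ik).
- by rewrite !size_upd ?size_upd.
- by rewrite !size_upd ?size_upd.
- by rewrite !size_upd ?size_upd.
- rewrite !stk_upd !eqxx (negbTE jk) upd_upd.
  rewrite (upd_updC (upd s i l) _ _ jk) upd_upd (upd_updC _ _ _ ik) (upd_updC _ _ _ ij) upd_upd.
  by rewrite rev_cons !cat_rcons.
- by rewrite /=; lia.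
Qed.

Lemma store_ext (s1 s2 : store) :
  size s1 = size s2 -> (forall i, stk s1 i = stk s2 i) -> s1 = s2.
Proof. by move=> h1 h2; apply: (@eq_from_nth _ [::]). Qed.

Lemma runs_copy_stack i j k s :
  i != j -> i != k -> j != k -> i < size s -> j < size s -> k < size s ->
  stk s k = [::] ->
  runs (copy_stack i j k) s (upd s j (stk s i ++ stk s j)) (7 * size (stk s i) + 2).
Proof.
move=> ij ik jk si sj sk e.
apply: (runs_conv (runs_seq (runs_move_stack ik si sk) (runs_move_stack2 _ _ ij _ _ _)));
  rewrite ?size_upd // 1?eq_sym // ?stk_upd ?eqxx.
  rewrite [k == i]eq_sym [j == k]eq_sym [j == i]eq_sym [k == j]eq_sym.
  rewrite (negbTE ij) (negbTE ik) (negbTE jk) e cats0 revK.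
  apply: store_ext => [|m]; first by rewrite !size_upd ?size_upd ?size_upd.
  rewrite !stk_upd; case: (m =P k) => [->|_]; first by rewrite eq_sym (negbTE jk) e.
  case: (m =P i) => [->|_]; first by rewrite (negbTE ij) cats0.
  by [].
by rewrite [k == i]eq_sym (negbTE ik) e cats0 size_rev; lia.
Qed.

Lemma runs_clear_stack i s :
  i < size s -> runs (clear_stack i) s (upd s i [::]) (3 * size (stk s i) + 1).
Proof.
move e : (stk s i) => l; elim: l s e => [|b l IH] s e si.
  apply: (runs_conv (runs_loop_nil _ _ e)) => //.
  by have := upd_id si; rewrite e.
have hb : runs (if b then Skip else Skip) (upd s i l) (upd s i l) 1.
  by case: b e => _; exact: runs_skip.
apply: (runs_conv (runs_loop_cons e hb (IH _ _ _))).
- by rewrite stk_upd eqxx.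
- by rewrite size_upd.
- by rewrite upd_upd.
- by rewrite /=; lia.
Qed.

Notation "c1 ;; c2" := (Seq c1 c2) (at level 60, right associativity).

(* Symbolic execution on a store given as an explicit list. *)
Ltac step1 := cbn [nth set_nth cat app head behead];
  first [ apply: runs_skip | apply: runs_push | apply: runs_drop; reflexivity
        | apply: runs_move_stack => // | apply: runs_copy_stack => //
        | apply: runs_clear_stack => // ].
Ltac exec_steps :=
  repeat (cbn [nth set_nth cat app head behead];
    first [ solve [step1] | apply: runs_seq
          | apply: runs_case_nil; [reflexivity | ]
          | apply: runs_case_cons; [reflexivity | ] ]).

Ltac iterate := eapply runs_conv;
  [eapply runs_loop_cons; [reflexivity | cbv iota; exec_steps | cbn [nth set_nth]] | | ].
Ltac use H := eapply runs_seq; [cbn [nth set_nth cat app head behead]; exact: H | ].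

Notation unary k := (nseq k true).

(** * From binary budgets to truncated unary ones *)

(* The programs below address the stacks by their index:
     0 the number n of vertices, in unary     11 maximum degree, later a buffer for 15
     1 the adjacency matrix, row by row       12 iteration counter
     2 the start vertex, later a buffer for 1 13 the current word
     3 b in binary, later a buffer for 14     14 burned vertices
     4 k in binary, later a copy of 14        15 saved vertices
     5 min(b, n) in unary                     16 unspent protections
     6 min(k, n) in unary                     17 vertices that may still burn
     7 buffer for 0 and 6                     18 flag or carry
     8 scratch                                19 unread part of the word
     9 scratch, later a buffer for 14         20 budget violations
    10 indicator of the start vertex          21 the answer
   Sets of vertices are lists of n booleans. *)
Definition double_acc := Loop 10 (Push 9 true ;; Push 9 true) Skip.
(** Applied after every bit and not once at the end, because the untruncated value can be
    exponential in the length of the input. *)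
Definition truncate :=
  Loop 0 (Push 7 true ;; Case 9 Skip (Push 10 true) Skip) Skip ;;
  clear_stack 9 ;; move_stack 7 0.
Definition horner :=
  Loop 8 (double_acc ;; Push 9 true ;; truncate) (double_acc ;; truncate).

Lemma rev_unary k : rev (unary k) = unary k.
Proof. exact: rev_nseq. Qed.

Lemma runs_double_acc N M x2 x3 x4 x5 x6 x7 x8 x rest a :
  runs double_acc [:: N, M, x2, x3, x4, x5, x6, x7, x8, unary x, unary a & rest]
    [:: N, M, x2, x3, x4, x5, x6, x7, x8, unary (2 * a + x), [::] & rest] (4 * a + 1).
Proof.
elim: a x => [|a IH] x; first by apply: runs_conv (runs_loop_nil _ _ _) _ _.
iterate.
- exact: (IH x.+2).
- by rewrite mulnS -!addSnnS.
- by lia.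
Qed.

Lemma runs_truncate_loop n n1 M x2 x3 x4 x5 x6 x8 x rest a :
  runs (Loop 0 (Push 7 true ;; Case 9 Skip (Push 10 true) Skip) Skip)
    [:: unary n, M, x2, x3, x4, x5, x6, unary n1, x8, unary x, unary a & rest]
    [:: [::], M, x2, x3, x4, x5, x6, unary (n + n1), x8, unary (x - n),
        unary (minn x n + a) & rest] (6 * n + 1).
Proof.
elim: n n1 x a => [|n IH] n1 x a.
  by apply: runs_conv (runs_loop_nil _ _ _) _ _ => //; rewrite subn0 minn0.
case: x => [|x]; iterate.
- exact: (IH n1.+1 0 a).
- by rewrite addnS !sub0n !min0n.
- by lia.
- exact: (IH n1.+1 x a.+1).
- by rewrite addnS subSS minnSS addnS.
- by lia.
Qed.

Lemma runs_truncate n M x2 x3 x4 x5 x6 x8 x rest :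
  runs truncate
    [:: unary n, M, x2, x3, x4, x5, x6, [::], x8, unary x, [::] & rest]
    [:: unary n, M, x2, x3, x4, x5, x6, [::], x8, [::], unary (minn x n) & rest]
    (9 * n + 3 * x + 3).
Proof.
eapply runs_conv.
- eapply runs_seq; first exact: (runs_truncate_loop n 0 _ _ _ _ _ _ _ x _ 0).
  exec_steps.
- by rewrite /= !cats0 rev_unary addn0 addn0.
- by rewrite /= !size_nseq; lia.
Qed.

Lemma runs_horner n M x2 x3 x4 x5 x6 l a rest :
  a <= n ->
  runs horner
    [:: unary n, M, x2, x3, x4, x5, x6, [::], l, [::], unary a & rest]
    [:: unary n, M, x2, x3, x4, x5, x6, [::], [::], [::],
        unary (foldl (fun a (b : bool) => minn (2 * a + b) n) a l) & rest]
    ((20 * n + 20) * size l + 1).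
Proof.
elim: l a => [|b l IH] a an.
  by apply: runs_conv (runs_loop_nil _ _ _) _ _; rewrite ?muln0.
have an' : minn (2 * a + b) n <= n by rewrite geq_minr.
have dbl := runs_double_acc (unary n) M x2 x3 x4 x5 x6 [::] l 0 rest a; rewrite addn0 in dbl.
have trc := runs_truncate n M x2 x3 x4 x5 x6 l (2 * a + b) rest.
have {}IH := IH _ an'.
case: b an' trc IH => _ /=; rewrite ?addn1 ?addn0 => trc IH; eapply runs_conv.
- eapply runs_loop_cons; [reflexivity | cbv iota | exact: IH].
  eapply runs_seq; first exact: dbl.
  eapply runs_seq; first by step1.
  exact: trc.
- by [].
- by rewrite /= mulnS; lia.
- eapply runs_loop_cons; [reflexivity | cbv iota | exact: IH].
  eapply runs_seq; [exact: dbl | exact: trc].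
- by [].
- by rewrite /= mulnS; lia.
Qed.

Definition to_unary i j := move_stack i 8 ;; horner ;; move_stack 10 j.

Lemma horner_le n l :
  foldl (fun a (b : bool) => minn (2 * a + b) n) 0 (rev l) <= n.
Proof. by elim/last_ind: (rev l) => //= l' b _; rewrite foldl_rcons geq_minr. Qed.

Lemma runs_to_unary5 n M x2 l x4 x6 rest :
  runs (to_unary 3 5)
    [:: unary n, M, x2, l, x4, [::], x6, [::], [::], [::], [::] & rest]
    [:: unary n, M, x2, [::], x4,
        unary (foldl (fun a (b : bool) => minn (2 * a + b) n) 0 (rev l)), x6,
        [::], [::], [::], [::] & rest]
    ((30 * n + 30) * (size l).+1).
Proof.
eapply runs_conv.
- eapply runs_seq; first by step1.
  use (@runs_horner n M x2 [::] x4 [::] x6 (rev l ++ [::]) 0 rest isT).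
  step1.
- by rewrite /= !cats0 rev_unary.
- have := horner_le n l; rewrite /= !cats0 !size_rev !size_nseq.
  by rewrite mulnS; nia.
Qed.

Lemma runs_to_unary6 n M x2 x3 l x5 rest :
  runs (to_unary 4 6)
    [:: unary n, M, x2, x3, l, x5, [::], [::], [::], [::], [::] & rest]
    [:: unary n, M, x2, x3, [::], x5,
        unary (foldl (fun a (b : bool) => minn (2 * a + b) n) 0 (rev l)),
        [::], [::], [::], [::] & rest]
    ((30 * n + 30) * (size l).+1).
Proof.
eapply runs_conv.
- eapply runs_seq; first by step1.
  use (@runs_horner n M x2 x3 [::] x5 [::] (rev l ++ [::]) 0 rest isT).
  step1.
- by rewrite /= !cats0 rev_unary.
- have := horner_le n l; rewrite /= !cats0 !size_rev !size_nseq.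
  by rewrite mulnS; nia.
Qed.

(** * Indicator of the start vertex *)

Definition mask_loop :=
  Loop 0 (Push 7 true ;; Case 8 (Push 9 false) (Push 9 false) (Push 9 true)) Skip.

(** The ones of [unary s] lie on top of a single [false], and only that [false] turns into a mark.
    Once the stack is empty no further mark is made, hence the default [true] in
    [runs_mask_loop]. *)
Definition make_mask :=
  Push 8 false ;; move_stack 2 8 ;; mask_loop ;; move_stack 7 0 ;; move_stack 9 10 ;;
  clear_stack 8.

Lemma runs_mask_loop n M x2 x3 x4 x5 x6 n1 l x rest :
  runs mask_loop
    [:: unary n, M, x2, x3, x4, x5, x6, unary n1, l, x & rest]
    [:: [::], M, x2, x3, x4, x5, x6, unary (n + n1), drop n l,
        rev (mkseq (fun i => ~~ nth true l i) n) ++ x & rest]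
    (6 * n + 1).
Proof.
elim: n n1 l x => [|n IH] n1 l x.
  by apply: runs_conv (runs_loop_nil _ _ _) _ _ => //; rewrite drop0.
have mkS f : mkseq f n.+1 = f 0 :: mkseq (fun i => f i.+1) n :> seq bool.
  by rewrite /mkseq /= (iotaDl 1 0 n) -map_comp.
rewrite mkS rev_cons cat_rcons addSnnS.
case: l => [|b l]; last case: b; (iterate; [exact: (IH n1.+1) | | lia]) => //=.
by rewrite (eq_mkseq (g := fun _ => false)) // => i; rewrite nth_nil.
Qed.

Lemma runs_make_mask n M s x3 x4 x5 x6 rest :
  s < n ->
  runs make_mask
    [:: unary n, M, unary s, x3, x4, x5, x6, [::], [::], [::], [::] & rest]
    [:: unary n, M, [::], x3, x4, x5, x6, [::], [::], [::], mkseq (fun i => i == s) n & rest]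
    (20 * n + 20).
Proof.
move=> sn; eapply runs_conv.
- eapply runs_seq; first by step1.
  eapply runs_seq; first by step1.
  use (runs_mask_loop n M [::] x3 x4 x5 x6 0).
  exec_steps.
- rewrite /= !cats0 !rev_unary addn0 revK.
  congr [:: _, _, _, _, _, _, _, _, _, _, _ & _].
  apply/eq_mkseq => i; rewrite nth_cat size_nseq nth_nseq.
  case: ltngtP => // [si|->]; last by rewrite subnn.
  by have -> : i - s = (i - s.+1).+1; [lia | rewrite /= nth_nil].
- by rewrite /= !(size_cat, size_rev, size_drop, size_mkseq, size_nseq) /=; lia.
Qed.

(** * Maximum degree *)

Definition degree_cell :=
  Case 1 Skip (Push 2 true ;; Case 11 Skip Skip Skip ;; Push 9 true) (Push 2 false).
(** Stack 10 serves merely as a counter of length [n], since stack 0 drives the outer loop. While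
    stack 9 gains the degree [c] of the row, stack 11 shrinks from [d] to the truncated [d - c];
    joining both gives [c + (d - c)], the maximum of the two. *)
Definition degree_row := Loop 10 (Push 8 true ;; degree_cell) (Push 8 false ;; degree_cell).
Lemma runs_degree_row N row M y x3 x4 x5 x6 x7 z c B d rest :
  size row = size B ->
  runs degree_row
    [:: N, row ++ M, y, x3, x4, x5, x6, x7, z, unary c, B, unary d & rest]
    [:: N, M, rev row ++ y, x3, x4, x5, x6, x7, rev B ++ z,
        unary (count id row + c), [::], unary (d - count id row) & rest]
    (11 * size B + 1).
Proof.
elim: B row y z c d => [|b B IH] [|v row] y z c d //=.
  by move=> _; apply: runs_conv (runs_loop_nil _ _ _) _ _ => //; rewrite subn0.
move=> [e]; rewrite !rev_cons !cat_rcons.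
case: v; [case: d => [|d]|];
  [move: (IH row (true :: y) (b :: z) c.+1 0 e)
  |move: (IH row (true :: y) (b :: z) c.+1 d e)
  |move: (IH row (false :: y) (b :: z) c d e)] => {}IH;
  case: b IH => IH; (iterate; [exact: IH | | lia]);
  by rewrite ?sub0n ?add1n ?addnS ?add0n ?subSS.
Qed.

Definition degree_loop :=
  Loop 0 (Push 7 true ;; degree_row ;; move_stack 8 10 ;; move_stack 11 9 ;; move_stack 9 11)
    Skip.
Definition max_degree := degree_loop ;; move_stack 7 0 ;; move_stack 2 1.

Lemma runs_degree_loop rows n n1 B M y d x3 x4 x5 x6 rest :
  all (fun row => size row == n) rows -> size B = n -> d <= n ->
  runs degree_loop
    [:: unary (size rows), flatten rows ++ M, y, x3, x4, x5, x6, unary n1, [::], [::], B,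
        unary d & rest]
    [:: [::], M, rev (flatten rows) ++ y, x3, x4, x5, x6, unary (size rows + n1), [::], [::], B,
        unary (foldl (fun d row => maxn d (count id row)) d rows) & rest]
    ((20 * n + 10) * size rows + 1).
Proof.
move=> + sB; elim: rows n1 y d => [|row rows IH] n1 y d /=.
  by move=> _ _; apply: runs_conv (runs_loop_nil _ _ _) _ _; rewrite ?muln0.
move=> /andP[/eqP er hr] dn.
have cn : count id row <= n by rewrite -er count_size.
have {}IH := IH n1.+1 (rev row ++ y) (maxn d (count id row)) hr.
rewrite geq_max dn cn in IH; have {}IH := IH isT.
eapply runs_conv.
- eapply runs_loop_cons; [reflexivity | cbv iota | exact: IH].
  eapply runs_seq; first by step1.
  rewrite -catA; use (@runs_degree_row (unary (size rows)) row (flatten rows ++ M) y x3 x4 x5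
    x6 (unary n1.+1) [::] 0 B d rest (etrans er (esym sB))).
  eapply runs_conv; [exec_steps | | ].
  + rewrite /= !cats0 revK !rev_unary addn0 -nseqD rev_unary.
    congr [:: _, _, _, _, _, _, _, _, _, _, _, nseq _ _ & _].
    by rewrite maxnE; lia.
  + rewrite /= !(size_cat, size_rev, size_nseq) /= sB.
    exact: leqnn.
- by rewrite rev_cat catA addnS.
- by rewrite /= mulnS; lia.
Qed.

Lemma runs_max_degree rows n B M x3 x4 x5 x6 rest :
  size rows = n -> size B = n -> all (fun row => size row == n) rows ->
  runs max_degree
    [:: unary n, flatten rows ++ M, [::], x3, x4, x5, x6, [::], [::], [::], B, [::] & rest]
    [:: unary n, flatten rows ++ M, [::], x3, x4, x5, x6, [::], [::], [::], B,
        unary (foldl (fun d row => maxn d (count id row)) 0 rows) & rest]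
    (40 * n * n + 40 * n + 10).
Proof.
move=> sr sB hr; have := @runs_degree_loop rows n 0 B M [::] 0 x3 x4 x5 x6 rest hr sB (leq0n n).
rewrite sr => h; eapply runs_conv.
- use h; exec_steps.
- by rewrite /= !cats0 revK !rev_unary addn0.
- have sf : size (flatten rows) = n * n.
    rewrite size_flatten /shape -{1}sr; elim: rows hr {sr h} => //= row rows IH.
    move=> /andP[/eqP -> /IH ->].
    by rewrite mulSn.
  by rewrite /= !(size_cat, size_rev, size_nseq) /= sf; lia.
Qed.

(** * The number of words *)

Definition double_counter :=
  Loop 12 (Push 8 true ;; Push 8 true) Skip ;; move_stack 8 12.
Definition pow_loop := Loop 11 (Push 9 true ;; double_counter) Skip.
Definition pow_outer := Loop 6 (Push 7 true ;; pow_loop ;; move_stack 9 11) Skip.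
Definition pow := pow_outer ;; move_stack 7 6.

Lemma runs_double_counter N M x2 x3 x4 x5 x6 x7 x9 B0 D c rest :
  runs double_counter
    [:: N, M, x2, x3, x4, x5, x6, x7, [::], x9, B0, D, unary c & rest]
    [:: N, M, x2, x3, x4, x5, x6, x7, [::], x9, B0, D, unary (2 * c) & rest]
    (10 * c + 2).
Proof.
have loop x : runs (Loop 12 (Push 8 true ;; Push 8 true) Skip)
    [:: N, M, x2, x3, x4, x5, x6, x7, unary x, x9, B0, D, unary c & rest]
    [:: N, M, x2, x3, x4, x5, x6, x7, unary (2 * c + x), x9, B0, D, [::] & rest] (4 * c + 1).
  elim: c x => [|c IH] x; first by apply: runs_conv (runs_loop_nil _ _ _) _ _.
  iterate; first exact: (IH x.+2).
    by rewrite mulnS -!addSnnS.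
  by lia.
eapply runs_conv.
- use (loop 0); exec_steps.
- by rewrite /= !cats0 addn0 rev_unary.
- by rewrite /= !size_nseq; lia.
Qed.

Lemma runs_pow_loop N M x2 x3 x4 x5 x6 x7 d1 B0 d c rest :
  runs pow_loop
    [:: N, M, x2, x3, x4, x5, x6, x7, [::], unary d1, B0, unary d, unary c & rest]
    [:: N, M, x2, x3, x4, x5, x6, x7, [::], unary (d + d1), B0, [::], unary (c * 2 ^ d) & rest]
    (d * (10 * (c * 2 ^ d) + 6) + 1).
Proof.
elim: d d1 c => [|d IH] d1 c.
  by apply: runs_conv (runs_loop_nil _ _ _) _ _; rewrite ?expn0 ?muln1.
eapply runs_conv.
- eapply runs_loop_cons; [reflexivity | cbv iota | exact: (IH d1.+1 (2 * c))].
  eapply runs_seq; first by step1.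
  exact: runs_double_counter.
- by rewrite expnS mulnCA mulnA addSnnS.
- rewrite expnS mulnCA mulnA; have : 0 < 2 ^ d by rewrite expn_gt0.
  by move: (2 ^ d) => P; nia.
Qed.

(** With an arbitrary initial value [c], repeated calls multiply up; [compute_time_factor] uses this
    four times. *)
Lemma runs_pow N M x2 x3 x4 x5 k d c B0 rest :
  runs pow
    [:: N, M, x2, x3, x4, x5, unary k, [::], [::], [::], B0, unary d, unary c & rest]
    [:: N, M, x2, x3, x4, x5, unary k, [::], [::], [::], B0, unary d,
        unary (c * 2 ^ (k * d)) & rest]
    (k * (d * (10 * (c * 2 ^ (k * d)) + 10) + 10) + 2).
Proof.
have loop k1 : runs pow_outer
    [:: N, M, x2, x3, x4, x5, unary k, unary k1, [::], [::], B0, unary d, unary c & rest]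
    [:: N, M, x2, x3, x4, x5, [::], unary (k + k1), [::], [::], B0, unary d,
        unary (c * 2 ^ (k * d)) & rest]
    (k * (d * (10 * (c * 2 ^ (k * d)) + 9) + 5) + 1).
  elim: k k1 c => [|k IH] k1 c.
    by apply: runs_conv (runs_loop_nil _ _ _) _ _; rewrite ?expn0 ?muln1.
  eapply runs_conv.
  - eapply runs_loop_cons; [reflexivity | cbv iota | exact: (IH k1.+1 (c * 2 ^ d))].
    eapply runs_seq; first by step1.
    use (@runs_pow_loop N M x2 x3 x4 x5 (unary k) (unary k1.+1) 0 B0 d c rest).
    eapply runs_conv; [exec_steps | | ].
    + by rewrite /= cats0 rev_unary addn0.
    + by rewrite /= !size_nseq; exact: leqnn.
  - by rewrite mulSn expnD mulnA addSnnS.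
  - have : c * 2 ^ d <= c * 2 ^ (k.+1 * d) by rewrite leq_mul2l leq_exp2l // leq_pmull ?orbT.
    have -> : c * 2 ^ d * 2 ^ (k * d) = c * 2 ^ (k.+1 * d) by rewrite mulSn expnD mulnA.
    rewrite /= ?size_nseq; move: (c * 2 ^ d) (c * 2 ^ (k.+1 * d)) => P R PR.
    have h : d * (10 * P + 9) <= d * (10 * R + 9) by rewrite leq_mul2l; lia.
    rewrite [k.+1 * _]mulSn; move: h; rewrite !mulnDr.
    lia.
eapply runs_conv.
- use (loop 0); exec_steps.
- by rewrite /= cats0 rev_unary addn0.
- by rewrite /= !size_nseq; nia.
Qed.

(** * Playing a word *)

Definition hits (row B : seq bool) : nat := count (fun p => p.1 && p.2) (zip row B).

Definition scan_loop :=
  Loop 14 (Push 3 true ;; Case 1 Skip (Push 2 true ;; Push 18 true) (Push 2 false))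
          (Push 3 false ;; Case 1 Skip (Push 2 true) (Push 2 false)).
Definition scan_row := scan_loop ;; move_stack 3 14.

Lemma runs_scan_row row N M Mt x4 x5 x6 x7 x8 x9 x10 x11 x12 x13 B P x16 x17 rest :
  size row = size B ->
  runs scan_row
    [:: N, row ++ M, Mt, [::], x4, x5, x6, x7, x8, x9, x10, x11, x12, x13, B, P, x16, x17,
        [::] & rest]
    [:: N, M, rev row ++ Mt, [::], x4, x5, x6, x7, x8, x9, x10, x11, x12, x13, B, P, x16, x17,
        unary (hits row B) & rest]
    (11 * size B + 2).
Proof.
have loop Bt h : size row = size B -> runs scan_loop
    [:: N, row ++ M, Mt, Bt, x4, x5, x6, x7, x8, x9, x10, x11, x12, x13, B, P, x16, x17,
        unary h & rest]
    [:: N, M, rev row ++ Mt, rev B ++ Bt, x4, x5, x6, x7, x8, x9, x10, x11, x12, x13, [::], P,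
        x16, x17, unary (hits row B + h) & rest] (8 * size B + 1).
  rewrite /hits; elim: B row Mt Bt h => [|b B IH] [|v row] Mt Bt h //=.
    by move=> _; apply: runs_conv (runs_loop_nil _ _ _) _ _.
  move=> [e]; rewrite !rev_cons !cat_rcons.
  have {}IH := IH row (v :: Mt) (b :: Bt) ((v && b) + h) e.
  by case: v IH; case: b => IH; (iterate; [exact: IH | | lia]);
    rewrite ?add1n ?add0n ?addSn ?addnS.
move=> e; eapply runs_conv.
- use (loop [::] 0 e); exec_steps.
- by rewrite /= !cats0 revK addn0.
- by rewrite /= cats0 size_rev; lia.
Qed.

(** Overspending leaves a mark on stack 20 and the play goes on. *)
Definition protect := Case 16 (Push 20 true) Skip Skip ;; Push 11 true ;; Push 9 false.
Definition burn := Case 17 (Push 20 true) Skip Skip ;; Push 11 false ;; Push 9 true.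
(** An exhausted word means protection, in agreement with the default [false] in [choice] and
    [word_choice]. *)
Definition choose := clear_stack 18 ;; Case 19 protect burn protect.
Definition vertex_protected :=
  scan_row ;; clear_stack 18 ;; Case 4 Skip (Push 9 true) (Push 9 false) ;; Push 11 true.
Definition vertex_unprotected :=
  scan_row ;;
  Case 4 Skip (clear_stack 18 ;; Push 11 false ;; Push 9 true)
    (If 18 (Push 11 false ;; Push 9 false) choose Skip).
(** All tests read the old burned set, kept on stack 14 and copied to stack 4, while the new one
    grows on stack 9. Thus the fire does not spread twice within a round. *)
Definition vertex_loop := Loop 15 vertex_protected vertex_unprotected.

Lemma runs_choose N M Mt x3 Bv x5 x6 x7 x8 Bn x10 Pn x12 x13 B P c k h w f rest :
  let bit := head false w in
  runs choose
    [:: N, M, Mt, x3, Bv, x5, x6, x7, x8, Bn, x10, Pn, x12, x13, B, P, unary c, unary k,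
        unary h, w, unary f & rest]
    [:: N, M, Mt, x3, Bv, x5, x6, x7, x8, bit :: Bn, x10, ~~ bit :: Pn, x12, x13, B, P,
        unary (c - ~~ bit), unary (k - bit), [::], behead w,
        unary (f + (~~ bit - c) + (bit - k)) & rest]
    (3 * h + 10).
Proof.
case: w => [|[] w] /=; [case: c => [|c] | case: k => [|k] | case: c => [|c]];
  (eapply runs_conv; [exec_steps | | rewrite /= size_nseq; lia]);
  by rewrite /= ?addn0 ?addn1 ?subn0 ?subn1.
Qed.

Section VertexLoop.
Variables (V : eqType) (row : V -> seq bool) (b p : V -> bool) (B : seq bool).
Hypothesis size_row : forall v, size (row v) = size B.

Definition on_fire_line (v : V) := [&& ~~ p v, ~~ b v & 0 < hits (row v) B].
Local Notation fr := on_fire_line.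
(** The loop pops one bit for each fire line vertex, so the bit of [v] sits at the rank of [v] among
    these. *)
Definition choice vs w v := nth false w (index v (filter fr vs)).

Lemma runs_vertex_loop vs N M Mt x5 x6 x7 x8 Bn x10 Pn x12 x13 c k w f rest :
  uniq vs ->
  let X v := fr v && choice vs w v in
  let Y v := fr v && ~~ choice vs w v in
  runs vertex_loop
    [:: N, flatten (map row vs) ++ M, Mt, [::], map b vs, x5, x6, x7, x8, Bn, x10, Pn,
        x12, x13, B, map p vs, unary c, unary k, [::], w, unary f & rest]
    [:: N, M, rev (flatten (map row vs)) ++ Mt, [::], [::], x5, x6, x7, x8,
        rev [seq b v || X v | v <- vs] ++ Bn, x10, rev [seq p v || Y v | v <- vs] ++ Pn,
        x12, x13, B, [::], unary (c - count Y vs), unary (k - count X vs), [::],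
        drop (count fr vs) w, unary (f + (count Y vs - c) + (count X vs - k)) & rest]
    ((14 * size B + 20) * size vs + 1).
Proof.
elim: vs Mt Bn Pn c k w f => [|v vs IH] Mt Bn Pn c k w f.
  move=> _ X Y; apply: runs_conv (runs_loop_nil _ _ _) _ _; rewrite ?muln0 //=.
  by rewrite !subn0 !addn0 drop0.
rewrite [uniq _]/= => /andP[vvs uvs] X Y.
(* Once [v] is passed, the ranks of the others drop by one exactly if [v] has used up a bit. *)
have hc u : u \in vs -> choice (v :: vs) w u = choice vs (drop (fr v) w) u.
  move=> uvs'; rewrite /choice /=; have vu : v != u by apply: contraNneq vvs => ->.
  by case: (fr v) => /=; rewrite ?drop0 ?drop1 // (negbTE vu) nth_behead.
have hX : {in vs, X =1 fun u => fr u && choice vs (drop (fr v) w) u}.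
  by move=> u uv; rewrite /X hc.
have hY : {in vs, Y =1 fun u => fr u && ~~ choice vs (drop (fr v) w) u}.
  by move=> u uv; rewrite /Y hc.
have mX : [seq b u || X u | u <- vs] = [seq b u || (fr u && choice vs (drop (fr v) w) u) | u <- vs].
  by apply/eq_in_map => u uv; rewrite hX.
have mY : [seq p u || Y u | u <- vs] =
          [seq p u || (fr u && ~~ choice vs (drop (fr v) w) u) | u <- vs].
  by apply/eq_in_map => u uv; rewrite hY.
rewrite /= mX mY (eq_in_count hX) (eq_in_count hY) !rev_cons !cat_rcons rev_cat -!catA.
have hv : fr v -> choice (v :: vs) w v = head false w.
  by move=> fv; rewrite /choice /= fv /= eqxx; case: (w).
have hB : hits (row v) B <= size B.
  by apply: leq_trans (count_size _ _) _; rewrite size_zip size_row minnn.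
have scn := @runs_scan_row (row v) N (flatten (map row vs) ++ M) Mt _ x5 x6 x7 x8 Bn x10 Pn
  x12 x13 B _ (unary c) (unary k) [:: w, unary f & rest] (size_row v).
have {}IH bv pv := IH (rev (row v) ++ Mt) (bv :: Bn) (pv :: Pn) _ _ (drop (fr v) w) _ uvs.
rewrite /X /Y.
case pv: (p v).
  have fv : fr v = false by rewrite /on_fire_line pv.
  rewrite fv in IH *; rewrite /= !add0n drop0 in IH *.
  rewrite orbF.
  case bv: (b v); eapply runs_conv.
  - eapply runs_loop_cons; [reflexivity | cbv iota | exact: (IH c k f true true)].
    use scn; exec_steps.
  - by [].
  - rewrite /= size_nseq; nia.
  - eapply runs_loop_cons; [reflexivity | cbv iota | exact: (IH c k f false true)].
    use scn; exec_steps.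
  - by [].
  - rewrite /= size_nseq; nia.
case bv: (b v).
  have fv : fr v = false by rewrite /on_fire_line pv bv.
  rewrite fv in IH *; rewrite /= !add0n drop0 in IH *.
  eapply runs_conv.
  - eapply runs_loop_cons; [reflexivity | cbv iota | exact: (IH c k f true false)].
    use scn; exec_steps.
  - by [].
  - rewrite /= size_nseq; nia.
case hs: (hits (row v) B) => [|h].
  have fv : fr v = false by rewrite /on_fire_line pv bv hs.
  rewrite fv in IH *; rewrite /= !add0n drop0 in IH *; rewrite hs in scn.
  eapply runs_conv.
  - eapply runs_loop_cons; [reflexivity | cbv iota | exact: (IH c k f false false)].
    use scn; apply: runs_case_cons; [reflexivity | ].
    apply: runs_if; exec_steps.
  - by [].
  - rewrite /=; nia.
have fv : fr v by rewrite /on_fire_line pv bv hs.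
rewrite (hv fv) fv in IH *; rewrite hs in scn; rewrite /= drop1 in IH *.
have -> : drop (1 + count fr vs) w = drop (count fr vs) (behead w).
  by rewrite -drop1 drop_drop addnC.
have hB' : h.+1 <= size B by rewrite -hs.
have chs := @runs_choose N (flatten (map row vs) ++ M) (rev (row v) ++ Mt) [::] (map b vs)
  x5 x6 x7 x8 Bn x10 Pn x12 x13 B (map p vs) c k h.+1 w f rest.
move: chs IH; set bit := head false w => chs /(_ (c - ~~ bit) (k - bit)
  (f + (~~ bit - c) + (bit - k)) bit (~~ bit)) IH; eapply runs_conv.
- eapply runs_loop_cons; [reflexivity | cbv iota | exact: IH].
  use scn; apply: runs_case_cons; [reflexivity | ].
  apply: runs_if; exact: chs.
- congr [:: _, _, _, _, _, _, _, _, _, _, _, _, _, _, _, _, nseq _ _, nseq _ _, _, _,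
          nseq _ _ & _]; rewrite /X /Y /=; lia.
- rewrite /=; nia.
Qed.
End VertexLoop.

(** * The game on finite sets *)

Record game (n : nat) := Game {
  burnt : {set 'I_n};
  saved : {set 'I_n};
  credit : nat;
  allowance : nat;
  word : seq bool;
  faults : nat
}.

Section Game.
Variables (n : nat) (e : rel 'I_n) (b : nat).

Definition fire_line (B P : {set 'I_n}) : {set 'I_n} :=
  [set v | [&& v \notin P, v \notin B & [exists u in B, e v u]]].

Definition word_choice (F : {set 'I_n}) (w : seq bool) : {set 'I_n} :=
  [set v in F | nth false w (index v (enum F))].

(** [faults] accumulates precisely what the truncated subtractions cut off, so the accounts are
    exact as long as it stays zero. *)
Definition game_round (g : game n) : game n :=
  let F := fire_line (burnt g) (saved g) in
  let X := word_choice F (word g) in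
  let Y := F :\: X in
  let c := credit g + b in
  Game (burnt g :|: X) (saved g :|: Y) (c - #|Y|) (allowance g - #|X|)
    (drop #|F| (word g)) (faults g + (#|Y| - c) + (#|X| - allowance g)).

Definition indicator (A : {set 'I_n}) : seq bool := [seq v \in A | v <- enum 'I_n].
Definition adjacency : seq (seq bool) := [seq [seq e v u | u <- enum 'I_n] | v <- enum 'I_n].

Lemma size_indicator A : size (indicator A) = n.
Proof. by rewrite size_map size_enum_ord. Qed.

Lemma size_adjacency : size (flatten adjacency) = n * n.
Proof.
rewrite size_flatten /shape -map_comp (eq_map (g := fun _ => n)).
  by rewrite sumnE big_map big_enum /= sum_nat_const card_ord.
by move=> v /=; rewrite size_map size_enum_ord.
Qed.

Definition round :=
  copy_stack 5 16 8 ;; copy_stack 14 4 8 ;; vertex_loop ;;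
  clear_stack 14 ;; move_stack 9 14 ;; move_stack 11 15 ;; move_stack 2 1.

Definition game_store N x6 x7 x10 x12 x13 Acc (g : game n) : store :=
  [:: N; flatten adjacency; [::]; [::]; [::]; unary b; x6; x7; [::]; [::]; x10; [::]; x12; x13;
      indicator (burnt g); indicator (saved g); unary (credit g); unary (allowance g); [::]; word g;
      unary (faults g); Acc].

Lemma enum_filter (A : {set 'I_n}) : enum A = filter (mem A) (enum 'I_n).
Proof. by rewrite {1}/enum_mem /= -enumT. Qed.

Lemma count_enum (A : {set 'I_n}) (p : pred 'I_n) :
  p =1 mem A -> count p (enum 'I_n) = #|A|.
Proof. by move=> h; rewrite (eq_count h) -size_filter -enum_filter -cardE. Qed.

Lemma hits_indicator v (B : {set 'I_n}) :
  (0 < hits [seq e v u | u <- enum 'I_n] (indicator B)) = [exists u in B, e v u].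
Proof.
rewrite /hits /indicator -has_count zip_map has_map; apply/hasP/exists_inP.
  by move=> [u _ /andP[h1 h2]]; exists u.
by move=> [u uB evu]; exists u; rewrite ?mem_enum //= evu.
Qed.

Lemma runs_round N x6 x7 x10 x12 x13 Acc g :
  b <= n ->
  runs round (game_store N x6 x7 x10 x12 x13 Acc g)
    (game_store N x6 x7 x10 x12 x13 Acc (game_round g)) (50 * (n + 1) * (n + 1)).
Proof.
move=> bn; case: g => B P c k w f; rewrite /game_store /=.
set F := fire_line B P; set X := word_choice F w; set Y := F :\: X.
pose row v := [seq e v u | u <- enum 'I_n].
have sr v : size (row v) = size (indicator B) by rewrite size_indicator size_map size_enum_ord.
have hF : on_fire_line row (mem B) (mem P) (indicator B) =1 mem F.
  by move=> v; rewrite /on_fire_line hits_indicator /= inE.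
have hc v : choice row (mem B) (mem P) (indicator B) (enum 'I_n) w v =
            nth false w (index v (enum F)).
  by rewrite /choice enum_filter (eq_filter hF).
have hX : (fun v => on_fire_line row (mem B) (mem P) (indicator B) v &&
                    choice row (mem B) (mem P) (indicator B) (enum 'I_n) w v) =1 mem X.
  by move=> v; rewrite hc hF /X [RHS]inE.
have hY : (fun v => on_fire_line row (mem B) (mem P) (indicator B) v &&
                    ~~ choice row (mem B) (mem P) (indicator B) (enum 'I_n) w v) =1 mem Y.
  move=> v; rewrite hc hF [RHS]inE [v \in X]inE /=.
  by case: (v \in F); rewrite ?andbT ?andbF.
have := @runs_vertex_loop _ row (mem B) (mem P) (indicator B) sr (enum 'I_n) N [::] [::] (unary b)
  x6 x7
  [::] [::] x10 [::] x12 x13 (b + c) k w f [:: Acc] (enum_uniq _).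
rewrite /= (count_enum hF) (count_enum hX) (count_enum hY).
rewrite (eq_map (f := fun v => mem B v || _) (g := mem (B :|: X))); last first.
  by move=> v /=; rewrite inE; congr orb; exact: hX.
rewrite (eq_map (f := fun v => mem P v || _) (g := mem (P :|: Y))); last first.
  by move=> v /=; rewrite inE; congr orb; exact: hY.
rewrite !cats0 size_enum_ord size_indicator => h.
eapply runs_conv.
- eapply runs_seq; first by step1.
  eapply runs_seq; first by step1.
  rewrite /= cats0 -nseqD; use h; exec_steps.
- by rewrite /= !cats0 !revK [b + c]addnC.
- rewrite /= !(size_cat, size_rev, size_map, size_nseq, size_adjacency) -!enumT !size_enum_ord.
  by nia.
Qed.

(** Bounds the stacks left over at the end of a play, which [play] must clear before the next
    word. *)
Lemma game_round_bound t g :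
  let g' := iter t game_round g in
  [/\ credit g' <= credit g + t * b, allowance g' <= allowance g,
      size (word g') <= size (word g) & faults g' <= faults g + t * (2 * n)].
Proof.
elim: t => [|t [IH1 IH2 IH3 IH4]] /=; first by split; lia.
have card_n (A : {set 'I_n}) : #|A| <= n by rewrite -[X in _ <= X]card_ord max_card.
set g' := iter t game_round g in IH1 IH2 IH3 IH4 *.
have := card_n (word_choice (fire_line (burnt g') (saved g')) (word g')).
have := card_n (fire_line (burnt g') (saved g') :\:
                word_choice (fire_line (burnt g') (saved g')) (word g')).
by rewrite /game_round /= size_drop => h1 h2; split; lia.
Qed.

Definition round_loop := Loop 0 (Push 7 true ;; round) Skip.

Lemma runs_round_loop t t1 x6 x10 x12 x13 Acc g :
  b <= n ->
  runs round_loop (game_store (unary t) x6 (unary t1) x10 x12 x13 Acc g)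
    (game_store [::] x6 (unary (t + t1)) x10 x12 x13 Acc (iter t game_round g))
    (t * (50 * (n + 1) * (n + 1) + 3) + 1).
Proof.
move=> bn; elim: t t1 g => [|t IH] t1 g; first by apply: runs_conv (runs_loop_nil _ _ _) _ _.
eapply runs_conv.
- eapply runs_loop_cons; [reflexivity | cbv iota | exact: (IH t1.+1 (game_round g))].
  eapply runs_seq; [by step1 | exact: runs_round].
- by rewrite -iterSr addSnnS.
- by rewrite [t.+1 * _]mulSn; lia.
Qed.

Variables (k : nat) (s : 'I_n).

Definition initial_game (w : seq bool) : game n := Game [set s] set0 0 k.-1 w 0.

Definition idle_store C W a : store :=
  [:: unary n; flatten adjacency; [::]; [::]; [::]; unary b; unary k; [::]; [::]; [::];
      indicator [set s]; [::]; C; W; [::]; [::]; [::]; [::]; [::]; [::]; [::]; unary a].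

Definition clear_saved_loop := Loop 0 (Push 7 true ;; Push 15 false) Skip.
Definition play :=
  copy_stack 10 14 8 ;; clear_saved_loop ;; move_stack 7 0 ;; copy_stack 13 19 8 ;;
  copy_stack 6 17 8 ;; Drop 17 ;; round_loop ;; move_stack 7 0 ;;
  If 20 (Push 21 true) Skip Skip ;; clear_stack 20 ;; clear_stack 19 ;; clear_stack 17 ;;
  clear_stack 16 ;; clear_stack 15 ;; clear_stack 14.

Lemma indicator0 : indicator set0 = nseq n false.
Proof.
rewrite /indicator (eq_map (g := fun _ => false)); last by move=> v; rewrite inE.
by rewrite -[in RHS](size_enum_ord n); elim: (enum _) => //= _ l ->.
Qed.

Definition survives (w : seq bool) : bool := faults (iter n game_round (initial_game w)) == 0.

Lemma runs_clear_saved_loop m x1 x2 x3 x4 x5 x6 x7 x8 x9 x10 x11 x12 x13 x14 x15 rest :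
  runs clear_saved_loop
    [:: unary m, x1, x2, x3, x4, x5, x6, unary x7, x8, x9, x10, x11, x12, x13, x14,
        nseq x15 false & rest]
    [:: [::], x1, x2, x3, x4, x5, x6, unary (m + x7), x8, x9, x10, x11, x12, x13, x14,
        nseq (m + x15) false & rest] (4 * m + 1).
Proof.
elim: m x7 x15 => [|m IH] x7 x15; first by apply: runs_conv (runs_loop_nil _ _ _) _ _.
iterate; first exact: (IH x7.+1 x15.+1).
  by rewrite !addnS.
by lia.
Qed.

Lemma runs_record_survival f a (st : store) :
  stk st 20 = unary f -> stk st 21 = unary a -> 21 < size st ->
  runs (If 20 (Push 21 true) Skip Skip) st (upd st 21 (unary ((f == 0) + a))) 2.
Proof.
move=> h20 h21 sz; case: f h20 => [|f] h20; apply: runs_if; rewrite h20 /=.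
  by have := runs_push 21 true st; rewrite h21.
by rewrite -h21 upd_id //; exact: runs_skip.
Qed.

Lemma runs_play C W a :
  b <= n -> 0 < k <= n ->
  runs play (idle_store C W a) (idle_store C W (survives W + a))
    (200 * (n + 1) * (n + 1) * (n + 1) + 10 * size W).
Proof.
move=> bn /andP[k0 kn]; rewrite /idle_store.
have clr := @runs_clear_saved_loop n (flatten adjacency) [::] [::] [::] (unary b) (unary k) 0 [::]
  [::] (indicator [set s]) [::] C W (indicator [set s]) 0
  [:: [::]; [::]; [::]; [::]; [::]; unary a].
have lp := @runs_round_loop n 0 (unary k) (indicator [set s]) C W (unary a) (initial_game W) bn.
have [hb1 hb2 hb3 hb4] := game_round_bound n (initial_game W).
move: lp hb1 hb2 hb3 hb4; rewrite /survives; set g := iter n game_round (initial_game W).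
move=> lp hb1 hb2 hb3 hb4; rewrite /= in hb1 hb2 hb3 hb4.
eapply runs_conv.
- eapply runs_seq; first by step1.
  rewrite /= cats0; use clr.
  eapply runs_seq; first by step1.
  eapply runs_seq; first by step1.
  eapply runs_seq; first by step1.
  eapply runs_seq.
    (* The start vertex burns from the outset and is charged here, whence the initial allowance
       [k.-1]. *)
    apply: (@runs_drop _ true (unary k.-1)); rewrite /= !cats0.
    by rewrite -{1}(prednK k0).
  rewrite /= !cats0 !addn0 rev_unary -indicator0; use lp.
  eapply runs_seq; first by step1.
  eapply runs_seq; first exact: (@runs_record_survival (faults g) a).
  exec_steps.
- by rewrite /= !cats0 !addn0 rev_unary.
- cbn [nth set_nth cat app head behead game_store].
  rewrite !(size_cat, size_rev, size_nseq, size_indicator).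
  have hb : n * b <= n * n by rewrite leq_mul2l bn orbT.
  rewrite [200 * _ * _ * _](_ : _ = 200 * (n * n * n) + 600 * (n * n) + 600 * n + 200); last by lia.
  rewrite [n * (_ + _)](_ : _ = 50 * (n * n * n) + 100 * (n * n) + 53 * n); last by lia.
  by lia.
Qed.

(** * Enumeration of words by a binary counter *)

Definition increment_loop :=
  Loop 13 (Case 18 (Push 8 true) (Push 18 true ;; Push 8 false) Skip)
          (Case 18 (Push 8 false) (Push 8 true) Skip).
Definition increment :=
  Push 18 true ;; increment_loop ;; Case 18 Skip (Push 8 true) Skip ;; move_stack 8 13.

Fixpoint inc (w : seq bool) : seq bool :=
  match w with
  | [::] => [:: true]
  | false :: w' => true :: w'
  | true :: w' => false :: inc w'
  end.

Lemma size_inc w : size (inc w) <= (size w).+1.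
Proof. by elim: w => //= -[] w IH //=. Qed.

Definition carry_add (c : bool) w := if c then inc w else w.

Lemma runs_increment_loop w (c : bool) y x0 x1 x2 x3 x4 x5 x6 x7 x9 x10 x11 x12 x14 x15 x16
    x17 rest :
  runs increment_loop
    [:: x0, x1, x2, x3, x4, x5, x6, x7, y, x9, x10, x11, x12, w, x14, x15, x16, x17,
        nseq c true & rest]
    [:: x0, x1, x2, x3, x4, x5, x6, x7, rev (take (size w) (carry_add c w)) ++ y, x9, x10, x11,
        x12, [::], x14, x15, x16, x17, nseq (c && all id w) true & rest] (6 * size w + 1).
Proof.
elim: w c y => [|v w IH] c y.
  by apply: runs_conv (runs_loop_nil _ _ _) _ _; rewrite ?andbT ?take0.
case: v; case: c; (iterate; [exact: (IH true) || exact: (IH false) | | rewrite /=; lia]);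
  by rewrite /= rev_cons cat_rcons.
Qed.

Lemma inc_carry w : inc w = take (size w) (inc w) ++ nseq (all id w) true.
Proof. by elim: w => //= -[] w /= IH; rewrite -?IH // take_size cats0. Qed.

Lemma runs_increment w x0 x1 x2 x3 x4 x5 x6 x7 x9 x10 x11 x12 x14 x15 x16 x17 rest :
  runs increment
    [:: x0, x1, x2, x3, x4, x5, x6, x7, [::], x9, x10, x11, x12, w, x14, x15, x16, x17, [::]
      & rest]
    [:: x0, x1, x2, x3, x4, x5, x6, x7, [::], x9, x10, x11, x12, inc w, x14, x15, x16, x17, [::]
      & rest] (10 * size w + 20).
Proof.
have lp := @runs_increment_loop w true [::] x0 x1 x2 x3 x4 x5 x6 x7 x9 x10 x11 x12 x14 x15 x16 x17.
move: lp; rewrite /= [in X in _ -> X]inc_carry; case: (all id w) => lp; eapply runs_conv.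
- eapply runs_seq; first by step1.
  use lp; exec_steps.
- by rewrite /= !cats0 rev_cons revK cats1.
- cbn [nth set_nth cat app head behead]; rewrite /= !(size_cat, size_rev) size_take /=.
  by case: ifP; lia.
- eapply runs_seq; first by step1.
  use lp; exec_steps.
- by rewrite /= !cats0 revK.
- cbn [nth set_nth cat app head behead]; rewrite /= !(size_cat, size_rev) size_take /=.
  by case: ifP; lia.
Qed.

Definition search := Loop 12 (play ;; increment) Skip.

(** The binary numeral of [m], least significant bit first, hence without trailing [false]. *)
Definition nth_word (m : nat) : seq bool := iter m inc [::].

Lemma size_nth_word m : size (nth_word m) <= m.
Proof. by elim: m => //= m IH; apply: leq_trans (size_inc _) _. Qed.

Lemma runs_search m i a :
  b <= n -> 0 < k <= n ->
  runs search (idle_store (unary m) (nth_word i) a)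
    (idle_store [::] (nth_word (i + m)) (count survives [seq nth_word j | j <- iota i m] + a))
    (m * (200 * (n + 1) * (n + 1) * (n + 1) + 20 * (i + m) + 30) + 1).
Proof.
move=> bn kn; elim: m i a => [|m IH] i a.
  by apply: runs_conv (runs_loop_nil _ _ _) _ _; rewrite ?addn0.
eapply runs_conv.
- eapply runs_loop_cons; [reflexivity | cbv iota | exact: (IH i.+1 (survives (nth_word i) + a))].
  eapply runs_seq; first exact: (@runs_play (unary m) _ _ bn kn).
  exact: runs_increment.
- by rewrite addSnnS addnCA addnA.
- have := size_nth_word i; rewrite [m.+1 * _]mulSn.
  have : m * (20 * (i.+1 + m)) = m * (20 * (i + m.+1)) by rewrite addSnnS.
  by rewrite addSnnS; lia.
Qed.
End Game.

(** * Correctness of the search *)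

Lemma nth_word_odd m : nth_word m.*2.+1 = true :: nth_word m.
Proof. by elim: m => // m IH; rewrite doubleS /nth_word iterS iterS -/(nth_word _) IH. Qed.

Lemma nth_word_even m : nth false (nth_word m.*2) =1 nth false (false :: nth_word m).
Proof.
case: m => [|m] i; first by rewrite /= nth_nil; case: i => //= i; rewrite nth_nil.
by rewrite doubleS /nth_word iterS -/(nth_word _) nth_word_odd.
Qed.

(** Numerals have no trailing [false], so a word is met only up to these; [faults_ext] shows that a
    play cannot tell the difference. *)
Lemma nth_word_surj w :
  exists2 m, m < 2 ^ size w & nth false (nth_word m) =1 nth false w.
Proof.
elim: w => [|v w [m hm IH]]; first by exists 0.
exists (v + m.*2); first by rewrite expnS -muln2; move: (2 ^ _) hm => P; case: v => /=; lia.
case: v => i; [rewrite nth_word_odd | rewrite nth_word_even]; case: i => //= i; exact: IH.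
Qed.

Section GameTheory.
Variables (n : nat) (e : rel 'I_n) (s : 'I_n) (b k : nat).
Hypothesis sym_e : symmetric e.
Hypothesis k_gt0 : 0 < k.

Local Notation rnd := (game_round e b).

Lemma word_choice_sub (F : {set 'I_n}) w : word_choice F w \subset F.
Proof. by apply/subsetP => v; rewrite inE => /andP[]. Qed.

Lemma faults_ext t B P c a f w1 w2 :
  nth false w1 =1 nth false w2 ->
  faults (iter t rnd (Game B P c a w1 f)) = faults (iter t rnd (Game B P c a w2 f)).
Proof.
elim: t B P c a f w1 w2 => [|t IH] B P c a f w1 w2 h //.
rewrite !iterSr /game_round /=.
have -> : word_choice (fire_line e B P) w1 = word_choice (fire_line e B P) w2.
  by apply/setP => v; rewrite !inE h.
by apply: IH => i; rewrite !nth_drop.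
Qed.

Lemma fire_lineP (B P : {set 'I_n}) v :
  reflect [/\ v \notin P, v \notin B & exists2 u, u \in B & e u v] (v \in fire_line e B P).
Proof.
rewrite inE; apply: (iffP and3P) => -[h1 h2 h3]; split=> //.
  by case/exists_inP: h3 => u uB; rewrite sym_e; exists u.
by case: h3 => u uB euv; apply/exists_inP; exists u; rewrite // sym_e.
Qed.

Lemma burnedS P t : burned e s P t.+1 = burned e s P t :|:
  [set v | (v \notin (ff_state e s P t.+1).2) && [exists u in burned e s P t, e u v]].
Proof. by []. Qed.

(** * From a surviving word to a strategy *)

Section Play.
Variable w : seq bool.
Local Notation G t := (iter t rnd (initial_game k s w)).
Local Notation F t := (fire_line e (burnt (G t)) (saved (G t))).
Local Notation X t := (word_choice (F t) (word (G t))).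
Local Notation Y t := (F t :\: X t).

Lemma burntS t : burnt (G t.+1) = burnt (G t) :|: X t.
Proof. by []. Qed.

Lemma savedS t : saved (G t.+1) = saved (G t) :|: Y t.
Proof. by []. Qed.

Lemma creditS t : credit (G t.+1) = credit (G t) + b - #|Y t|.
Proof. by []. Qed.

Lemma allowanceS t : allowance (G t.+1) = allowance (G t) - #|X t|.
Proof. by []. Qed.

Lemma faultsS t : faults (G t.+1) =
  faults (G t) + (#|Y t| - (credit (G t) + b)) + (#|X t| - allowance (G t)).
Proof. by []. Qed.

Lemma disjoint_burnt_X t : [disjoint burnt (G t) & X t].
Proof.
apply/pred0P => v /=; apply/negP => /andP[vB].
by move/(subsetP (word_choice_sub _ _)) => /fire_lineP[_]; rewrite vB.
Qed.

Lemma disjoint_saved_Y t : [disjoint saved (G t) & Y t].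
Proof.
apply/pred0P => v /=; apply/negP => /andP[vP].
by rewrite inE => /andP[_ /fire_lineP[]]; rewrite vP.
Qed.

Lemma disjoint_burnt_saved t : [disjoint burnt (G t) & saved (G t)].
Proof.
elim: t => [|t IH]; first by rewrite /= disjoint_sym -setI_eq0 set0I.
rewrite burntS savedS; apply/pred0P => v /=; apply/negP => /andP[].
rewrite !in_setU => /orP[vB|vX] /orP[vP|].
- by have /pred0P/(_ v) := IH; rewrite /= vB vP.
- by rewrite in_setD => /andP[_ /fire_lineP[_]]; rewrite vB.
- by move/(subsetP (word_choice_sub _ _)): vX => /fire_lineP[]; rewrite vP.
- by rewrite in_setD vX.
Qed.

Lemma burnt_mono t t' : t <= t' -> burnt (G t) \subset burnt (G t').
Proof.
move=> /subnK <-; elim: (t' - t) => //= m IH; apply: subset_trans IH _.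
exact: subsetUl.
Qed.

Lemma saved_mono t t' : t <= t' -> saved (G t) \subset saved (G t').
Proof.
move=> /subnK <-; elim: (t' - t) => //= m IH; apply: subset_trans IH _.
exact: subsetUl.
Qed.

Lemma faults_mono t t' : t <= t' -> faults (G t) <= faults (G t').
Proof.
move=> /subnK <-; elim: (t' - t) => // m IH; apply: leq_trans IH _.
by rewrite addSn faultsS -addnA leq_addr.
Qed.

Lemma quiet_round t : F t = set0 ->
  [/\ burnt (G t.+1) = burnt (G t), saved (G t.+1) = saved (G t) &
      faults (G t.+1) = faults (G t)].
Proof.
move=> F0; rewrite burntS savedS /= F0.
have -> : word_choice (set0 : {set 'I_n}) (word (G t)) = set0.
  by apply/eqP; rewrite -subset0 word_choice_sub.
by rewrite setD0 !setU0 cards0 !sub0n !addn0.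
Qed.

(* A round in which nothing burns leaves no vertex on the fire line, and at
   most [n] rounds can burn something. *)
Lemma fire_line_final t : n <= t -> F t = set0.
Proof.
have quietS m : F m = set0 -> F m.+1 = set0.
  by move=> F0; have [hb hp _] := quiet_round F0; rewrite hb hp.
have quiet_or_big m : F m = set0 \/ m < #|burnt (G m)|.
  elim: m => [|m [F0|IH]]; first by right; rewrite cards1.
    by left; exact: quietS.
  have [X0|] := eqVneq (X m) set0.
    left; apply/eqP; rewrite -subset0; apply/subsetP => v /fire_lineP[].
    rewrite burntS savedS X0 setU0 setD0 in_setU negb_or => /andP[vP vF] vB h.
    by case/negP: vF; apply/fire_lineP.
  rewrite -card_gt0 => X0; right; rewrite burntS cardsU.
  have := disjoint_burnt_X m; rewrite -setI_eq0 => /eqP ->; rewrite cards0; lia.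
have Fn : F n = set0.
  case: (quiet_or_big n) => // h; have := max_card (mem (burnt (G n))).
  by rewrite card_ord leqNgt h.
by move=> /subnK <-; elim: (t - n) => // m; exact: quietS.
Qed.

Hypothesis no_faults : faults (G n) = 0.

Lemma faults0 t : faults (G t) = 0.
Proof.
case: (leqP t n) => [tn|nt]; first by apply/eqP; rewrite -leqn0 -no_faults faults_mono.
rewrite -(subnK (ltnW nt)); elim: (t - n) => // m IH.
by have [_ _ ->] := quiet_round (fire_line_final (leq_addl m n)).
Qed.

(** Without faults no subtraction has truncated, so spent and unspent amounts always add up to the
    full budgets. *)
Lemma budgets t :
  credit (G t) + #|saved (G t)| = b * t /\ allowance (G t) + #|burnt (G t)| = k.
Proof.
elim: t => [|t [IHc IHa]]; first by rewrite /= cards0 cards1 muln0; split=> //; lia.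
have := faults0 t.+1; rewrite burntS savedS !cardsU.
have := disjoint_burnt_X t; rewrite -setI_eq0 => /eqP ->.
have := disjoint_saved_Y t; rewrite -setI_eq0 => /eqP ->.
rewrite creditS allowanceS faultsS cards0 mulnS => h; split; lia.
Qed.

Fixpoint queue (t : nat) : seq 'I_n := if t is t'.+1 then queue t' ++ enum (Y t') else [::].

Lemma mem_queue t : queue t =i saved (G t).
Proof.
elim: t => [|t IH] v; first by rewrite /= inE.
by rewrite savedS mem_cat IH mem_enum in_setU.
Qed.

Lemma size_queue t : size (queue t) = #|saved (G t)|.
Proof.
elim: t => [|t IH]; first by rewrite /= cards0.
have := disjoint_saved_Y t; rewrite -setI_eq0 => /eqP h.
by rewrite size_cat IH -cardE savedS cardsU h cards0 subn0.
Qed.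

Lemma queue_prefix t : prefix (queue t) (queue n).
Proof.
have mono t' : t <= t' -> prefix (queue t) (queue t').
  move=> /subnK <-; elim: (t' - t) => [|m IH]; first exact: prefix_refl.
  exact: prefix_trans IH (prefix_prefix _ _).
case: (leqP t n) => [|nt]; first exact: mono.
suff -> : queue t = queue n by exact: prefix_refl.
rewrite -(subnK (ltnW nt)); elim: (t - n) => // m IH.
by rewrite addSn /= fire_line_final ?leq_addl // set0D enum_set0 cats0.
Qed.

(* The vertices the play saves are protected in the order in which the fire
   would reach them, [b] at a time. *)
Definition queue_strategy (t : nat) : {set 'I_n} :=
  [set v in take b (drop (b * t.-1) (queue n))].

Lemma protected_queue t :
  (ff_state e s queue_strategy t).2 = [set v in take (b * t) (queue n)].
Proof.
elim: t => [|t IH] /=; first by rewrite muln0 take0; apply/setP => v; rewrite !inE.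
by rewrite IH mulnS addnC takeD; apply/setP => v; rewrite !inE mem_cat.
Qed.

(** By [budgets] at most [b * t] vertices are saved within [t] rounds. They form a prefix of the
    final queue, and the strategy has by then protected its first [b * t] entries. *)
Lemma saved_protected t : saved (G t) \subset (ff_state e s queue_strategy t).2.
Proof.
apply/subsetP => v; rewrite -mem_queue protected_queue inE.
have /prefixP[l ->] := queue_prefix t.
have [] := budgets t; rewrite -size_queue => h _ vq.
by rewrite take_cat ltnNge -h leq_addl /= mem_cat vq.
Qed.

(** A vertex that catches fire under the strategy is unprotected, hence unsaved by
    [saved_protected]; if it is not burnt yet, it lies on the fire line of the play, which can then
    only burn it. *)
Lemma burned_burnt t : burned e s queue_strategy t \subset burnt (G t).
Proof.
elim: t => // t IH; apply/subsetP => v; rewrite burnedS in_setU => /orP[/(subsetP IH) vB|].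
  by apply: (subsetP (burnt_mono (leqnSn t))).
rewrite inE => /andP[vP /exists_inP[u /(subsetP IH) uB euv]].
have {}vP : v \notin saved (G t.+1).
  by apply: contra vP => /(subsetP (saved_protected t.+1)).
rewrite burntS in_setU; case: (boolP (v \in burnt (G t))) => //= vB.
move: vP; rewrite savedS in_setU negb_or => /andP[vP vY].
have vF : v \in F t by apply/fire_lineP; split=> //; exists u.
by move: vY; rewrite in_setD vF andbT negbK.
Qed.

Lemma survives_sound : Firefighter e s b k.
Proof.
exists queue_strategy; split=> t; last first.
  have [_ h] := budgets t; apply: leq_trans (subset_leq_card (burned_burnt t)) _.
  by rewrite -[leqRHS]h leq_addl.
split.
  rewrite cardsE; apply: leq_trans (card_size _) _; rewrite size_take.
  by case: ltnP.
apply/pred0P => v /=; apply/negP => /andP[].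
rewrite inE => /mem_take/mem_drop; rewrite mem_queue => vP /(subsetP (burned_burnt t)) vB.
(* The queue contains vertices saved possibly long after round [t], so both sets are compared at a
   round that is late enough for each. *)
have /pred0P/(_ v) /= := disjoint_burnt_saved (maxn t n).
by rewrite (subsetP (burnt_mono (leq_maxl t n))) // (subsetP (saved_mono (leq_maxr t n))).
Qed.

End Play.

Lemma iter_burnt_sub t g : burnt g \subset burnt (iter t rnd g).
Proof.
elim: t => // t IH; apply: subset_trans IH _; exact: subsetUl.
Qed.

(** * From a strategy to a surviving word *)

Section Replay.
Variable P : nat -> {set 'I_n}.
Hypothesis valid_P : valid_strategy e s b P.
Hypothesis few_burned : forall t, #|burned e s P t| <= k.

Local Notation protected t := (ff_state e s P t).2.

Lemma card_protected t : #|protected t| <= b * t.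
Proof.
elim: t => [|t IH]; first by rewrite /= cards0.
rewrite [protected _]/= mulnS addnC; have [h _] := valid_P t.
by apply: leq_trans (leq_card_setU _ _) (leq_add IH h).
Qed.

Lemma protectedS t : protected t \subset protected t.+1.
Proof. exact: subsetUl. Qed.

(** The two inclusions keep the play within the budgets of the strategy, and [touched] is what
    finally bounds the length of the word by degrees. *)
Record consistent (t : nat) (g : game n) : Prop := {
  burnt_burned : burnt g \subset burned e s P t;
  saved_protected_by : saved g \subset protected t;
  burnt_saved : [disjoint burnt g & saved g];
  touched : forall v, v \in burnt g :|: saved g ->
    v = s \/ exists2 u, u \in burnt g & e u v;
  saved_budget : credit g + #|saved g| = b * t;
  burnt_budget : allowance g + #|burnt g| = k;
  faultless : faults g = 0
}.

(** The word is only discovered as the play unfolds, so states are related with their words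
    exchanged. *)
Definition with_word (w : seq bool) (g : game n) : game n :=
  Game (burnt g) (saved g) (credit g) (allowance g) w (faults g).

(* Burning exactly the fire line vertices that [P] leaves unprotected never
   exceeds the budgets. *)
Lemma replay_round t g : consistent t g ->
  exists bits g', [/\ consistent t.+1 g',
    forall w, rnd (with_word (bits ++ w) g) = with_word w g' &
    size bits + (#|burnt g| + #|saved g|) = #|burnt g'| + #|saved g'|].
Proof.
case: g => B S c a w0 f [hB hS dBS ht hc ha hf].
cbn [burnt saved credit allowance faults] in hB, hS, dBS, ht, hc, ha, hf |- *.
set F := fire_line e B S; exists [seq v \notin protected t.+1 | v <- enum F].
set X := F :\: protected t.+1; set Y := F :\: X.
have eX w : word_choice F ([seq v \notin protected t.+1 | v <- enum F] ++ w) = X.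
  apply/setP => v; rewrite [LHS]inE [RHS]in_setD; case vF : (v \in F); rewrite ?andbF //= andbT.
  rewrite nth_cat size_map index_mem mem_enum vF.
  by rewrite (nth_map v) ?index_mem ?mem_enum // nth_index ?mem_enum.
have XF : X \subset F by exact: subsetDl.
have YF : Y \subset F by exact: subsetDl.
have dX : B :&: X = set0.
  apply/setP => v; rewrite in_setI in_set0; apply/negP => /andP[vB /(subsetP XF)].
  by case/fire_lineP => _; rewrite vB.
have dY : S :&: Y = set0.
  apply/setP => v; rewrite in_setI in_set0; apply/negP => /andP[vS /(subsetP YF)].
  by case/fire_lineP; rewrite vS.
have hX : B :|: X \subset burned e s P t.+1.
  rewrite burnedS; apply/subsetP => v; rewrite !in_setU => /orP[/(subsetP hB) -> //|].
  rewrite in_setD => /andP[vP /fire_lineP[_ _ [u uB euv]]]; apply/orP; right.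
  by rewrite inE vP; apply/exists_inP; exists u => //; exact: (subsetP hB).
have hY : S :|: Y \subset protected t.+1.
  rewrite subUset (subset_trans hS (protectedS t)); apply/subsetP => v.
  by rewrite !in_setD; case: (v \in F); rewrite ?andbF // !andbT negbK.
(* The inclusions [hY] and [hX] bound the enlarged sets by [b * t.+1] and [k], so neither
   subtraction of the new state truncates. *)
have cS := card_protected t.+1; rewrite mulnS in cS; have cB := few_burned t.+1.
have := subset_leq_card hX; have := subset_leq_card hY;
rewrite (cardsU S Y) (cardsU B X) dX dY cards0 !subn0.
move=> /leq_trans/(_ cS) cY /leq_trans/(_ cB) cX {cS cB}.
have cF : #|X| + #|Y| = #|F|.
  by rewrite -[#|F|](cardsID X) (setIidPr XF).
exists (Game (B :|: X) (S :|: Y) (c + b - #|Y|) (a - #|X|) w0 0); split.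
- split=> //; cbn [burnt saved credit allowance].
  + apply/pred0P => v /=; apply/negP => /andP[]; rewrite !in_setU => /orP[vB|vX] /orP[vS|vY].
    * by have /pred0P/(_ v) := dBS; rewrite /= vB vS.
    * by case/(subsetP YF)/fire_lineP: vY => _; rewrite vB.
    * by case/(subsetP XF)/fire_lineP: vX; rewrite vS.
    * by move: vY; rewrite in_setD vX.
  + have new v : v \in F -> exists2 u, u \in B :|: X & e u v.
      by case/fire_lineP => _ _ [u uB euv]; exists u; rewrite // in_setU uB.
    move=> v; rewrite !in_setU -orbA => /or4P[vB|vX|vS|vY].
    * have [|->|[u uB euv]] := ht v; [by rewrite in_setU vB | by left | right].
      by exists u; rewrite // in_setU uB.
    * by right; apply: new; apply: (subsetP XF).
    * have [|->|[u uB euv]] := ht v; [by rewrite in_setU vS orbT | by left | right].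
      by exists u; rewrite // in_setU uB.
    * by right; apply: new; apply: (subsetP YF).
  + by rewrite cardsU dY cards0 mulnS; lia.
  + by rewrite cardsU dX cards0; lia.
- move=> w; rewrite /game_round /with_word.
  cbn [burnt saved credit allowance word faults]; rewrite -/F eX -/Y.
  rewrite drop_size_cat ?size_map -?cardE //.
  by congr Game; rewrite hf; lia.
- by cbn [burnt saved]; rewrite size_map -cardE !cardsU dX dY cards0; lia.
Qed.

Lemma replay m t g : consistent t g ->
  exists w g', [/\ consistent (t + m) g', iter m rnd (with_word w g) = with_word [::] g' &
    size w + (#|burnt g| + #|saved g|) = #|burnt g'| + #|saved g'|].
Proof.
elim: m t g => [|m IH] t g hg; first by exists [::], g; rewrite addn0.
have [bits [g0 [hg0 e0 s0]]] := replay_round hg; have [w [g' [hg' e' s']]] := IH _ _ hg0.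
exists (bits ++ w), g'; rewrite iterSr e0 e' size_cat addnS -addSn; split=> //; lia.
Qed.

Lemma survives_complete : exists2 w, size w <= k * maxdeg e & survives e b k s w.
Proof.
have h0 : consistent 0 (initial_game k s [::]).
  split=> //=.
  - by rewrite disjoint_sym -setI_eq0 set0I.
  - by move=> v; rewrite in_setU !inE orbF => /eqP; left.
  - by rewrite cards0 muln0.
  - by rewrite cards1; lia.
have [w [g' [[hB hS dBS ht _ ha hf] eg sz]]] := replay n h0.
have ew : initial_game k s w = with_word w (initial_game k s [::]) by [].
exists w; last by rewrite /survives ew eg /= hf.
rewrite /= cards1 cards0 addn0 in sz.
have {sz} -> : size w = #|(burnt g' :|: saved g') :\ s|.
  have sB : s \in burnt g'.
    have := @iter_burnt_sub n (with_word w (initial_game k s [::])); rewrite eg => /subsetP; apply.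
    by rewrite /= inE.
  have := cardsD1 s (burnt g' :|: saved g'); rewrite in_setU sB cardsU.
  by move: dBS; rewrite -setI_eq0 => /eqP ->; rewrite cards0 orTb subn0 -sz addn1 add1n => -[].
have nbrs : (burnt g' :|: saved g') :\ s \subset \bigcup_(u in burnt g') [set v | e v u].
  apply/subsetP => v; rewrite in_setD1 => /andP[vs /ht[vE|[u uB euv]]].
    by rewrite vE eqxx in vs.
  by apply/bigcupP; exists u => //; rewrite inE sym_e.
apply: leq_trans (subset_leq_card nbrs) _.
apply: (@leq_trans (\sum_(u in burnt g') #|[set v | e v u]|)).
  elim/big_rec2: _ => [|u m A _ IH]; first by rewrite cards0.
  by apply: leq_trans (leq_card_setU _ _) _; rewrite leq_add2l.
apply: (@leq_trans (#|burnt g'| * maxdeg e)); last by rewrite leq_mul2r -ha leq_addl orbT.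
rewrite -sum_nat_const; apply: leq_sum => u _.
have -> : [set v | e v u] = [set v | e u v] by apply/setP => v; rewrite !inE sym_e.
exact: (leq_bigmax (F := fun u => #|[set v | e u v]|)).
Qed.

End Replay.
Lemma FirefighterP :
  Firefighter e s b k <->
  has (survives e b k s) [seq nth_word m | m <- iota 0 (2 ^ (k * maxdeg e))].
Proof.
split=> [[P [vP fP]]|/hasP[w _ hw]]; last first.
  by apply: (@survives_sound w); apply/eqP.
have [w sw hw] := survives_complete vP fP; have [m hm em] := nth_word_surj w.
apply/hasP; exists (nth_word m).
  apply: map_f; rewrite mem_iota add0n; apply: leq_trans hm _.
  by rewrite leq_exp2l.
by move: hw; rewrite /survives /initial_game (faults_ext _ _ _ _ _ _ em).
Qed.

End GameTheory.

(** * The decision procedure *)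

Fixpoint pos_bools (p : positive) : seq bool :=
  match p with
  | xH => [:: true]
  | xO p' => false :: pos_bools p'
  | xI p' => true :: pos_bools p'
  end.

Definition bools (m : nat) : seq bool :=
  match N.of_nat m with N0 => [::] | Npos p => pos_bools p end.

Lemma bin_bools m : bin m = bsyms (bools m).
Proof. by rewrite /bin /bools; case: (N.of_nat m) => //; elim=> //= p ->. Qed.

(** Truncation passes through Horner steps: [minn (2 * minn a n + b) n = minn (2 * a + b) n]. *)
Lemma horner_bools n m :
  foldl (fun a (b : bool) => minn (2 * a + b) n) 0 (rev (bools m)) = minn m n.
Proof.
rewrite foldl_rev /bools; case e : (N.of_nat m) => [|p] /=; first by lia.
have -> : m = Pos.to_nat p by lia.
elim: p {m e} => [p /= ->|p /= ->|] /=; lia.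
Qed.

Lemma foldl_max_degree n (e : rel 'I_n) :
  foldl (fun d row => maxn d (count id row)) 0 (adjacency e) = maxdeg e.
Proof.
have gen d (l : seq (seq bool)) : foldl (fun d row => maxn d (count id row)) d l =
   maxn d (\max_(row <- l) count id row).
  by elim: l d => [|row l IH] d; rewrite ?big_nil ?maxn0 //= big_cons IH maxnA.
rewrite gen max0n big_map big_enum; apply: eq_bigr => v _.
by rewrite count_map (@count_enum n [set u | e v u]) // => u; rewrite /= inE.
Qed.

Lemma mkseq_indicator n (s : 'I_n) : mkseq (fun i => i == s) n = indicator [set s].
Proof.
rewrite /mkseq -val_enum_ord -map_comp /indicator; apply: eq_map => v /=.
by rewrite inE -val_eqE.
Qed.

Lemma maxdeg_le n (e : rel 'I_n) : maxdeg e <= n.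
Proof. by apply/bigmax_leqP => v _; rewrite -[leqRHS]card_ord max_card. Qed.

Definition decide :=
  to_unary 3 5 ;; to_unary 4 6 ;; make_mask ;; max_degree ;; Push 12 true ;; pow ;;
  clear_stack 11 ;; search.

Definition input_store n (e : rel 'I_n) (s : 'I_n) b k : store :=
  [:: unary n; flatten (adjacency e); unary s; bools b; bools k].

Lemma content_input n (e : rel 'I_n) s b k : content (input_store e s b k) = encode e s b k.
Proof.
rewrite /content /after /input_store /encode /= cats0 /bsyms !map_nseq !bin_bools.
rewrite /adjacency map_flatten -map_comp.
congr (_ ++ _ :: flatten _ ++ _); apply: eq_map => v /=.
by rewrite -map_comp.
Qed.

Lemma runs_decide n (e : rel 'I_n) (s : 'I_n) b k :
  0 < k ->
  let kk := minn k n in let bb := minn b n in let L := 2 ^ (kk * maxdeg e) in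
  exists2 s', stk s' 21 =
      unary (count (survives e bb kk s) [seq nth_word m | m <- iota 0 L]) &
    runs decide (input_store e s b k ++ nseq 17 [::]) s'
     ((30 * n + 30) * (size (bools b)).+1 + (30 * n + 30) * (size (bools k)).+1 +
      (20 * n + 20) + (40 * n * n + 40 * n + 10) + 1 +
      (kk * (maxdeg e * (10 * L + 10) + 10) + 2) + (3 * maxdeg e + 1) +
      (L * (200 * (n + 1) * (n + 1) * (n + 1) + 20 * L + 30) + 1)).
Proof.
move=> k0 kk bb L.
have n0 : 0 < n by apply: leq_ltn_trans (ltn_ord s).
have hb : bb <= n by rewrite geq_minr.
have hk : 0 < kk <= n by rewrite geq_minr andbT leq_min k0.
pose st := idle_store e bb kk s [::] (nth_word L)
  (count (survives e bb kk s) [seq nth_word m | m <- iota 0 L]).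
exists st => //.
have sr : size (adjacency e) = n by rewrite size_map size_enum_ord.
have ar : all (fun row => size row == n) (adjacency e).
  by apply/allP => row /mapP[v _ ->]; rewrite size_map size_enum_ord.
eapply runs_conv.
- eapply runs_seq; first exact: runs_to_unary5.
  eapply runs_seq; first exact: runs_to_unary6.
  eapply runs_seq; first exact: (runs_make_mask _ _ _ _ _ _ (ltn_ord s)).
  rewrite !horner_bools mkseq_indicator -[flatten (adjacency e)]cats0.
  eapply runs_seq.
    exact: (runs_max_degree _ _ _ _ _ _ sr (size_indicator _) ar).
  rewrite foldl_max_degree cats0.
  eapply runs_seq; first by step1.
  eapply runs_seq; first exact: (@runs_pow _ _ _ _ _ _ _ _ 1).
  rewrite mul1n; eapply runs_seq; first by step1.
  exact: (runs_search e s L 0 0 hb hk).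
- by rewrite add0n addn0.
- by rewrite /= size_nseq add0n mul1n !addnA.
Qed.

(** * The time factor and the final bounds *)

Definition compute_time_factor := move_stack 0 6 ;; move_stack 1 11 ;; Push 12 true ;;
  pow ;; pow ;; pow ;; pow ;; move_stack 12 21.

(** The search is charged quadratically in the number of words, as the length of the [m]-th word is
    only bounded by [m]; compilation squares this, which gives the exponent 4. *)
Definition time_factor (x y : nat) : nat := (2 ^ (x * y)) ^ 4.

Lemma runs_compute_time_factor x y :
  exists s' t, stk s' 21 = unary (time_factor x y) /\
    runs compute_time_factor ([:: unary x; unary y] ++ nseq 20 [::]) s' t.
Proof.
eexists; eexists; split; last first.
  eapply runs_seq; first by step1.
  eapply runs_seq; first by step1.
  eapply runs_seq; first by step1.
  rewrite /= !cats0 !rev_unary.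
  eapply runs_seq; first exact: (@runs_pow _ _ _ _ _ _ x y 1).
  do 3 (eapply runs_seq; first exact: runs_pow).
  step1.
by rewrite /= cats0 rev_unary /time_factor mul1n !expnS expn0 muln1 !mulnA.
Qed.

Lemma computable_time_factor : computable2 time_factor.
Proof.
exists (machine 2 22 compute_time_factor) => x y.
have [s' [t [e [u _ ex]]]] := runs_compute_time_factor x y.
have [t' _ [h o]] := @machineP 2 22 compute_time_factor [:: unary x; unary y] s' u
  erefl erefl erefl erefl ex.
exists t', (head false (stk s' 21)).
have -> : nseq x S1 ++ Sep :: nseq y S1 = content [:: unary x; unary y].
  by rewrite /content /after /= cats0 /bsyms !map_nseq.
by split=> //; rewrite o e /bsyms map_nseq.
Qed.

Lemma decide_time n B K k D L Z :
  0 < L -> k <= n -> D <= n -> n < Z -> B < Z -> K < Z ->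
  (30 * n + 30) * B.+1 + (30 * n + 30) * K.+1 +
      (20 * n + 20) + (40 * n * n + 40 * n + 10) + 1 +
      (k * (D * (10 * L + 10) + 10) + 2) + (3 * D + 1) +
      (L * (200 * (n + 1) * (n + 1) * (n + 1) + 20 * L + 30) + 1) + 1
  <= 900 * (Z * Z * Z * (L * L)).
Proof.
move=> L0 kn Dn nZ BZ KZ; set A := Z * Z * Z * (L * L).
have Z0 : 0 < Z by apply: leq_ltn_trans nZ.
(* All monomials of the running time have degree at most 3 in [Z] and at most 2 in [L], so [A]
   dominates each of them. *)
have mono i j : i <= 3 -> j <= 2 -> Z ^ i * L ^ j <= A.
  move=> i3 j2; have -> : A = Z ^ 3 * L ^ 2 by rewrite /A !expnS !expn0 !muln1 !mulnA.
  by rewrite leq_mul // leq_pexp2l.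
have m10 := mono 1 0 isT isT; have m20 := mono 2 0 isT isT; have m01 := mono 0 1 isT isT.
have m02 := mono 0 2 isT isT; have m21 := mono 2 1 isT isT; have m31 := mono 3 1 isT isT.
have m00 := mono 0 0 isT isT.
rewrite !expnS !expn0 !muln1 ?mul1n in m10 m20 m01 m02 m21 m31 m00.
have h1 : (n + 1) * B.+1 <= Z * Z by rewrite leq_mul // addn1.
have h2 : (n + 1) * K.+1 <= Z * Z by rewrite leq_mul // addn1.
have h3 : n * n <= Z * Z by rewrite leq_mul // ltnW.
have kZ : k <= Z by apply: leq_trans kn (ltnW nZ).
have DZ : D <= Z by apply: leq_trans Dn (ltnW nZ).
have h4 : k * (D * L) <= Z * (Z * L) by rewrite leq_mul // leq_mul.
have h5 : k * D <= Z * Z by rewrite leq_mul.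
have h6 : (n + 1) * ((n + 1) * (n + 1)) * L <= Z * (Z * Z) * L by rewrite !leq_mul // addn1.
clearbody A; clear mono.
(* The sum is regrouped into the products bounded above; once these are generalised, the goal is
   linear. *)
set T := (X in X <= _).
have -> : T = 30 * ((n + 1) * B.+1) + 30 * ((n + 1) * K.+1) + 40 * (n * n) +
    10 * (k * (D * L)) + 10 * (k * D) + 200 * ((n + 1) * ((n + 1) * (n + 1)) * L) +
    20 * (L * L) + 30 * L + 60 * n + 10 * k + 3 * D + 36 by rewrite /T; lia.
rewrite [Z * (Z * L)]mulnA in h4.
move: (leq_trans h1 m20) (leq_trans h2 m20) (leq_trans h3 m20) (leq_trans h4 m21)
  (leq_trans h5 m20) (leq_trans h6 m31) (leq_trans (ltnW nZ) m10) (leq_trans kZ m10)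
  (leq_trans DZ m10) m01 m02 m00.
move: ((n + 1) * B.+1) ((n + 1) * K.+1) (n * n) (k * (D * L)) (k * D)
  ((n + 1) * ((n + 1) * (n + 1)) * L) (L * L).
lia.
Qed.

Theorem theorem3 :
  exists (M : TM) (f : nat -> nat -> nat) (c : nat),
    computable2 f /\
    forall (n : nat) (e : rel 'I_n) (s : 'I_n) (b k : nat),
      symmetric e -> irreflexive e -> 0 < b -> 0 < k ->
      exists (t : nat) (ans : bool),
        t <= f k (maxdeg e) * (size (encode e s b k)) ^ c /\
        halted_with M (encode e s b k) t ans /\
        (ans = true <-> Firefighter e s b k).
Proof.
(* [19 = 6 + (3 + 5 + 5)]: squaring [Z ^ 3 * L ^ 2] yields [Z ^ 6], and the constants 20, 900 and
   1000 are absorbed by [Z ^ 3], [Z ^ 5] and [Z ^ 5], where the four separators of the input ensure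
   [4 <= Z]. *)
exists (machine 5 22 decide), time_factor, 19; split; first exact: computable_time_factor.
move=> n e s b k sym_e _ _ k0.
have n0 : 0 < n by apply: leq_ltn_trans (ltn_ord s).
have [s' es' [t tT ex]] := @runs_decide n e s b k k0.
move: es' tT; set kk := minn k n; set bb := minn b n; set L := 2 ^ (kk * maxdeg e) => es' tT.
have [t' t'T [h _]] := @machineP 5 22 decide (input_store e s b k) s' t
  erefl erefl erefl erefl ex.
rewrite content_input in t'T h.
exists t', (head false (stk s' 21)); split; last split=> //.
  set Z := size (encode e s b k) in t'T *.
  have Zn : n + n * n + s + size (bools b) + size (bools k) + 4 = Z.
    have sc (x : sym) u : size (x :: u) = (size u).+1 by [].
    rewrite /Z /encode !bin_bools.
    rewrite !(size_cat, sc, size_nseq, size_allpairs, size_map) -!enumT !size_enum_ord; lia.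
  set A := Z * Z * Z * (L * L).
  have tA : t + 1 <= 900 * A.
    have := @decide_time n (size (bools b)) (size (bools k)) kk (maxdeg e) L Z.
    rewrite expn_gt0 geq_minr maxdeg_le; lia.
  have Z4 : 4 <= Z by rewrite -Zn leq_addl.
  have ZA : Z + 24 <= 100 * A.
    have LL : 0 < L * L by rewrite muln_gt0 expn_gt0.
    have h1 : 4 * 4 * Z * 1 <= A by rewrite !leq_mul.
    lia.
  have LA : A * A <= time_factor k (maxdeg e) * Z ^ 6.
    have -> : A * A = L ^ 4 * Z ^ 6 by rewrite /A !expnS !expn0; lia.
    rewrite leq_mul2r leq_exp2r // leq_exp2l // leq_mul2r geq_minl !orbT //.
  have p3 : 20 <= Z ^ 3 by apply: (@leq_trans (4 ^ 3)); rewrite ?leq_exp2r.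
  have p5 : 1000 <= Z ^ 5 by apply: (@leq_trans (4 ^ 5)); rewrite ?leq_exp2r.
  have p5' : 900 <= Z ^ 5 by apply: leq_trans p5.
  apply: leq_trans t'T _.
  apply: (@leq_trans (Z ^ 3 * (Z ^ 5 * A) * (Z ^ 5 * A))).
    apply: leq_mul; last first.
      by apply: (@leq_trans (1000 * A)); [lia | rewrite leq_mul2r p5 orbT].
    by apply: leq_mul => //; apply: leq_trans tA _; rewrite leq_mul2r p5' orbT.
  apply: (@leq_trans (A * A * (Z ^ 3 * Z ^ 5 * Z ^ 5))).
    by move: (Z ^ 3) (Z ^ 5) => P Q; lia.
  rewrite -!expnD (_ : 19 = 6 + (3 + 5 + 5)) // [Z ^ (6 + _)]expnD mulnA.
  by rewrite leq_mul2r LA orbT.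
(* No set of vertices has more than [n] elements, so cutting either budget down to [n] changes
   nothing. *)
have -> : Firefighter e s b k <-> Firefighter e s bb kk.
  split=> [[P [vP fP]]|[P [vP fP]]]; exists P; split=> t0.
  - have [h1 h2] := vP t0; split=> //; rewrite leq_min h1 /=.
    by rewrite -[leqRHS]card_ord max_card.
  - by rewrite leq_min fP -[leqRHS]card_ord max_card.
  - have [h1 h2] := vP t0; split=> //; apply: leq_trans h1 _; exact: geq_minl.
  - by apply: leq_trans (fP t0) _; exact: geq_minl.
(* The last stack counts the surviving words in unary, so its top is [true] as soon as there is
   one. *)
rewrite (@FirefighterP n e s bb kk sym_e) ?leq_min ?k0 // has_count es' -/L.
by case: (count _ _).
Qed.
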